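(* For every odd prime $p$, $$\mathrm{pq}(p)=2p-1\qquad\text{and}\qquad \mathrm{pq}(p^2)=6p^2-p-1.$$
   Context: A quasigroup is a set $A$ with a binary operation $*$ such that for all $a,b\in A$ the equations $a*x=b$ and $y*a=b$ have unique solutions $x,y\in A$. A quasigroup $(A,* )$ is paramedial if $(x*y)*(u*v)=(v*y)*(u*x)$ for all $x,y,u,v\in A$. For a positive integer $n$, $\mathrm{pq}(n)$ denotes the number of paramedial quasigroups of order $n$ (i.e. with $n$ elements), up to isomorphism. *)

(* Defs.v *)
From mathcomp Require Import all_boot.

Set Implicit Arguments.
Unset Strict Implicit.
Unset Printing Implicit Defensive.

Section Quasigroups.

Variable T : finType.
Implicit Types f g : {ffun T * T -> T}.

Definition is_quasigroup f : bool :=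
  [forall a, forall b,
     (#|[set x | f (a, x) == b]| == 1) && (#|[set y | f (y, a) == b]| == 1)].

Definition is_paramedial f : bool :=
  [forall x, forall y, forall u, forall v,
     f (f (x, y), f (u, v)) == f (f (v, y), f (u, x))].

Definition isomorphic f g : bool :=
  [exists s : {ffun T -> T}, injectiveb s &&
     [forall x, forall y, s (f (x, y)) == g (s x, s y)]].

Lemma isomorphicP f g :
  reflect (exists2 s : T -> T, bijective s &
             forall x y, s (f (x, y)) = g (s x, s y))
          (isomorphic f g).
Proof.
apply: (iffP existsP) => [[s /andP[/injectiveP s_inj /forallP sM]]|[s s_bij sM]].
  exists s => [|x y]; first exact: injF_bij.
  by move: (sM x) => /forallP/(_ y)/eqP.
exists (finfun s); apply/andP; split.
  by apply/injectiveP => x y; rewrite !ffunE; apply: bij_inj.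
by apply/forallP => x; apply/forallP => y; rewrite !ffunE sM.
Qed.

Lemma isomorphic_equiv : equivalence_rel isomorphic.
Proof.
have refl f : isomorphic f f.
  by apply/isomorphicP; exists id => //; exists id.
have sym f g : isomorphic f g -> isomorphic g f.
  case/isomorphicP=> s [t sK tK] sM; apply/isomorphicP; exists t; first by exists s.
  by move=> x y; rewrite -{1}[x]tK -{1}[y]tK -sM sK.
have trans f g h : isomorphic f g -> isomorphic g h -> isomorphic f h.
  case/isomorphicP=> s s_bij sM /isomorphicP[t t_bij tM]; apply/isomorphicP.
  by exists (t \o s) => [|x y /=]; [exact: bij_comp | rewrite sM tM].
move=> f g h; split=> // fg.
by apply/idP/idP => [fh|]; [exact: trans (sym _ _ fg) fh | exact: trans fg].
Qed.

Definition paramedial_quasigroups : {set {ffun T * T -> T}} :=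
  [set f | is_quasigroup f && is_paramedial f].

End Quasigroups.

(* Every quasigroup of order n is isomorphic to one with carrier 'I_n, so the
   isomorphism classes of order n are those of the operations on 'I_n. *)
Definition pq (n : nat) : nat :=
  #|equivalence_partition (@isomorphic 'I_n) (paramedial_quasigroups 'I_n)|.

(* Main.v *)
Require Import Defs.
From HB Require Import structures.
From mathcomp Require Import all_boot all_order all_fingroup all_algebra.
From mathcomp Require Import all_solvable mxabelem ring zify.

(** The problem is linear in disguise. A paramedial quasigroup is affine over
    an abelian group: x * y = phi x + psi y + c, where phi and psi are
    automorphisms with phi^2 = psi^2 ([paramedial_affine]); and the isomorphisms
    between two affine quasigroups are the affine bijections that intertwine
    the coefficients ([affine_op_isoP]). So one counts the triples (phi, psi, c)
    up to conjugacy, the constant c mattering only modulo the image of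
    1 - phi - psi. A group of order p is cyclic, and one of order p^2 is cyclic
    or a plane over F_p ([zmod_prime], [zmod_prime_square]).

    On a cyclic group of order p^k, phi is multiplication by a unit w, and
    psi = w or psi = - w because p is odd. If psi = - w then 1 - phi - psi = 1,
    so that c = 0 can be assumed; if psi = w then c can be taken to be a power
    of p that divides 1 - 2 w. This gives 2 totient(p^k) + sum_(1 <= i <= k)
    p^(k - i) classes ([card_cyclic_form]), that is 2 p - 1 for k = 1, and
    2 p^2 - p + 1 for k = 2.

    On the plane, put phi = u + v and psi = u - v: then phi^2 = psi^2 becomes
    u v = - v u. If u v <> 0, anticommutation forces tr u = tr v = 0, so that
    u^2 and v^2 are scalars, and these scalars nearly determine the pair; if
    u v = 0, then u or v vanishes or both are diagonal of rank one
    in a common basis. This yields the list [normal_form] of 4 p^2 - 3 p - 1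
    conjugacy classes ([classification], [nf_pair_inj]). Each of them carries
    one class with c = 0, and exactly one more if 1 - 2 u is singular
    ([coker_transitive]), which happens for 3 p - 1 of them. The plane thus
    contributes 4 p^2 - 2 classes ([card_elementary_form]). *)

Set Implicit Arguments.
Unset Strict Implicit.
Unset Printing Implicit Defensive.

Import GRing.Theory FinRing.Theory.

(** * Isomorphism of binary operations and counting *)

Section Isotypes.

(** Isomorphism of operations on possibly different carriers, so that the
    operations on ['I_n] can be compared with those on rings and planes. *)
Definition op_iso (A B : Type) (f : A -> A -> A) (g : B -> B -> B) :=
  exists2 s : A -> B, bijective s & {morph s : x y / f x y >-> g x y}.

Lemma op_iso_sym A B (f : A -> A -> A) (g : B -> B -> B) :
  op_iso f g -> op_iso g f.
Proof.
case=> s [t sK tK] sM; exists t; first by exists s.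
by move=> x y; rewrite -{1}[x]tK -{1}[y]tK -sM sK.
Qed.

Lemma op_iso_trans A B C (f : A -> A -> A) (g : B -> B -> B)
    (h : C -> C -> C) : op_iso f g -> op_iso g h -> op_iso f h.
Proof.
case=> s s_bij sM [t t_bij tM]; exists (t \o s); first exact: bij_comp.
by move=> x y /=; rewrite sM tM.
Qed.

Definition paramedial_quasigroup (A : Type) (f : A -> A -> A) :=
  [/\ forall a, bijective (f a), forall a, bijective (f^~ a) &
      forall x y u v, f (f x y) (f u v) = f (f v y) (f u x)].

Lemma bij_conj A B (s : A -> B) (h : A -> A) (k : B -> B) :
  bijective s -> (forall x, s (h x) = k (s x)) -> bijective h -> bijective k.
Proof.
case=> t sK tK hk [h' hK h'K].
exists (s \o h' \o t) => x /=; first by rewrite -{1}[x]tK -hk sK hK tK.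
by rewrite -hk h'K tK.
Qed.

Lemma op_iso_paramedial_quasigroup A B (f : A -> A -> A) (g : B -> B -> B) :
  op_iso f g -> paramedial_quasigroup f -> paramedial_quasigroup g.
Proof.
case=> s s_bij sM [fl fr fP]; case: (s_bij) => t sK tK; split=> [a|a|x y u v].
- by apply: (bij_conj s_bij _ (fl (t a))) => x; rewrite sM tK.
- by apply: (bij_conj s_bij _ (fr (t a))) => x; rewrite sM tK.
by rewrite -[x]tK -[y]tK -[u]tK -[v]tK -!sM fP.
Qed.

Lemma unique_preimage_bij (T : finType) (h : T -> T) :
  (forall b, #|[set x | h x == b]| = 1) <-> bijective h.
Proof.
split=> [h1|h_bij b].
  apply: injF_bij => x y hxy; have /eqP/cards1P[z zP] := h1 (h x).
  have: x \in [set z] by rewrite -zP inE.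
  have: y \in [set z] by rewrite -zP inE hxy.
  by rewrite !inE => /eqP-> /eqP->.
case: (h_bij) => t hK tK; rewrite -(cards1 (t b)); congr #|pred_of_set _|.
by apply/setP=> x; rewrite !inE; apply/eqP/eqP => [<-|->]; rewrite ?hK ?tK.
Qed.

Lemma paramedial_quasigroupsP (T : finType) (f : {ffun T * T -> T}) :
  (f \in paramedial_quasigroups T) <->
  paramedial_quasigroup (fun x y => f (x, y)).
Proof.
rewrite inE; split=> [/andP[/forallP q /forallP m]|[fl fr fP]].
  split=> [a|a|x y u v].
  - by apply/unique_preimage_bij=> b; have /forallP/(_ b)/andP[/eqP] := q a.
  - by apply/unique_preimage_bij=> b; have /forallP/(_ b)/andP[_ /eqP] := q a.
  by have /forallP/(_ y)/forallP/(_ u)/forallP/(_ v)/eqP := m x.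
apply/andP; split; last first.
  by do 4![apply/forallP=> ?]; apply/eqP; apply: fP.
apply/forallP=> a; apply/forallP=> b; apply/andP; split; apply/eqP.
  by apply/unique_preimage_bij: b.
by apply/unique_preimage_bij: b; apply: fr.
Qed.

Lemma isomorphic_op_iso (T : finType) (f g : {ffun T * T -> T}) :
  isomorphic f g <-> op_iso (fun x y => f (x, y)) (fun x y => g (x, y)).
Proof.
by split=> [/isomorphicP[s s_bij sM]|[s s_bij sM]]; last apply/isomorphicP;
  exists s.
Qed.

Definition ord_op n (A : finType) (eA : #|A| = n) (f : A -> A -> A) :
    {ffun 'I_n * 'I_n -> 'I_n} :=
  let val i := enum_val (cast_ord (esym eA) i) in
  [ffun xy => cast_ord eA (enum_rank (f (val xy.1) (val xy.2)))].

Lemma ord_op_iso n (A : finType) (eA : #|A| = n) (f : A -> A -> A) :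
  op_iso f (fun x y => ord_op eA f (x, y)).
Proof.
exists (fun x => cast_ord eA (enum_rank x)).
  exists (fun i => enum_val (cast_ord (esym eA) i)) => x.
    by rewrite cast_ordK enum_rankK.
  by rewrite enum_valK cast_ordKV.
by move=> x y; rewrite ffunE /= !cast_ordK !enum_rankK.
Qed.

(** A family of pairwise inequivalent representatives that meets every class
    is in bijection with the classes. *)
Lemma card_equivalence_partition (T X : finType) (E : rel T) (D : {set T})
    (r : X -> T) :
    equivalence_rel E -> (forall x, r x \in D) ->
    (forall x y, E (r x) (r y) -> x = y) ->
    (forall f, f \in D -> exists x, E (r x) f) ->
  #|equivalence_partition E D| = #|X|.
Proof.
move=> E_eqv rD r_inj r_surj.
pose cls f := [set g in D | E f g].
have clsE f g : E f g -> cls f = cls g.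
  move=> fg; apply/setP=> h; rewrite !inE.
  by have [_ /(_ fg)->] := E_eqv f g h.
have Err f : E f f by have [] := E_eqv f f f.
suff ->: equivalence_partition E D = [set cls (r x) | x in [set: X]].
  rewrite card_imset ?cardsT // => x y /setP/(_ (r y)).
  by rewrite !inE rD Err /= => /r_inj.
apply/setP=> C; apply/imsetP/imsetP.
  case=> f fP ->; have [x xf] := r_surj f fP; exists x; rewrite ?inE //.
  by rewrite (clsE _ _ xf).
by case=> x _ ->; exists (r x).
Qed.

Lemma pq_card n (X : finType) (r : X -> {ffun 'I_n * 'I_n -> 'I_n}) :
    (forall x, r x \in paramedial_quasigroups 'I_n) ->
    (forall x y, isomorphic (r x) (r y) -> x = y) ->
    (forall f, f \in paramedial_quasigroups 'I_n ->
       exists x, isomorphic (r x) f) ->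
  pq n = #|X|.
Proof. exact/card_equivalence_partition/isomorphic_equiv. Qed.

End Isotypes.

(** * Affine operations and the structure theorem *)

Section AffineOperations.
Local Open Scope ring_scope.

Definition affine_op (A : zmodType) (phi psi : A -> A) (c x y : A) : A :=
  phi x + psi y + c.

Definition additive_perm (A B : zmodType) (phi : A -> B) :=
  bijective phi /\ {morph phi : x y / x + y}.

Definition paramedial_pair (A : zmodType) (phi psi : A -> A) :=
  [/\ additive_perm phi, additive_perm psi &
      forall x, phi (phi x) = psi (psi x)].

Lemma morph_add0 (A B : zmodType) (h : A -> B) :
  {morph h : x y / x + y} -> h 0 = 0.
Proof. by move=> hD; apply: (addrI (h 0)); rewrite -hD !addr0. Qed.

Lemma morph_addN (A B : zmodType) (h : A -> B) :
  {morph h : x y / x + y} -> {morph h : x / - x}.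
Proof.
by move=> hD x; apply: (addrI (h x)); rewrite -hD !subrr (morph_add0 hD).
Qed.

Lemma morph_addMn (A B : zmodType) (h : A -> B) n :
  {morph h : x y / x + y} -> {morph h : x / x *+ n}.
Proof.
move=> hD x; elim: n => [|n IHn]; first by rewrite !mulr0n (morph_add0 hD).
by rewrite !mulrS hD IHn.
Qed.

Lemma affine_op_paramedial (A : zmodType) (phi psi : A -> A) c :
  paramedial_pair phi psi -> paramedial_quasigroup (affine_op phi psi c).
Proof.
case=> [[[phi' phiK phi'K] phiD] [[psi' psiK psi'K] psiD] pp].
rewrite /affine_op; split=> [a|a|x y u v].
- exists (fun z => psi' (z - c - phi a)) => z.
    by rewrite addrK [phi a + _]addrC addrK.
  by rewrite psi'K [_ + (_ - _)]addrC !subrK.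
- by exists (fun z => phi' (z - c - psi a)) => z; rewrite ?phi'K ?addrK ?subrK.
rewrite !phiD !psiD !pp.
by rewrite [LHS](AC (3*3*1) (5*2*3*(4*1*6)*7)).
Qed.

(** An isomorphism s is affine, because phi x and psi y are arbitrary elements;
    its linear part al is a group isomorphism that intertwines phi and psi, and
    the last condition is the preservation of the operation at (0, 0), where
    b = s 0. *)
Lemma affine_op_isoP (A B : zmodType) (phi psi : A -> A) (c : A)
    (phi' psi' : B -> B) (c' : B) :
    paramedial_pair phi psi -> paramedial_pair phi' psi' ->
  op_iso (affine_op phi psi c) (affine_op phi' psi' c') <->
  exists (al : A -> B) (b : B),
    [/\ additive_perm al, forall x, al (phi x) = phi' (al x),
        forall x, al (psi x) = psi' (al x) &
        al c + b = phi' b + psi' b + c'].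
Proof.
case=> [[[fi fK fiK] fD] [[gi gK giK] gD] _].
case=> [[[fi' fK' fiK'] fD'] [[gi' gK' giK'] gD'] _].
rewrite /affine_op; split; last first.
  case=> al [b [[[la alK laK] alD] alf alg alc]].
  exists (fun x => al x + b).
    by exists (fun y => la (y - b)) => x; rewrite ?addrK ?alK ?laK ?subrK.
  move=> x y; rewrite !alD alf alg -addrA alc fD' gD'.
  by rewrite [LHS](AC (2*3) (1*3*(2*4)*5)).
case=> s [t sK tK] sM.
have f0 := morph_add0 fD; have g0 := morph_add0 gD.
have f'0 := morph_add0 fD'; have g'0 := morph_add0 gD'.
(* x + y is phi of phi^-1 x plus psi of psi^-1 y: evaluate sM there, and
     wherever one argument is zero *)
have hD x y : s (x + y + c) + s c = s (x + c) + s (y + c).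
  have := sM (fi x) (gi y); have := sM (fi x) 0; have := sM 0 (gi y).
  have := sM 0 0; rewrite !f0 !g0 !fiK !giK !add0r !addr0 => -> -> -> ->.
  by rewrite [LHS](AC (3*3) (1*5*3*(4*2*6))).
have sD x y : s (x + y) + s 0 = s x + s y.
  have hy := hD x (y - c); have hx := hD x (- c).
  rewrite addrA !subrK in hy; rewrite addNr subrK in hx.
  apply: (addIr (s c)).
  by rewrite addrAC hy addrAC -hx addrAC.
exists (fun x => s x - s 0), (s 0).
have f'B := morph_addN fD'; have g'B := morph_addN gD'.
have sc : s c = phi' (s 0) + psi' (s 0) + c'.
  by have := sM 0 0; rewrite f0 g0 !add0r.
split; last by rewrite subrK.
- split.
    by exists (fun y => t (y + s 0)) => x; rewrite ?subrK ?sK ?tK ?addrK.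
  by move=> x y; rewrite addrACA -sD addrA addrK.
- move=> x; rewrite fD' f'B; have := sD (phi x) c.
  have := sM x 0; rewrite g0 addr0 => ->; rewrite sc.
  move=> e; apply: (addIr (s c)); rewrite addrAC sc -e addrK.
  by rewrite !addrA subrK.
move=> x; rewrite gD' g'B; have := sD (psi x) c.
have := sM 0 x; rewrite f0 add0r => ->; rewrite sc.
move=> e; apply: (addIr (s c)); rewrite addrAC sc -e addrK.
by rewrite [in RHS](addrC (phi' (s 0))) !addrA subrK (addrC (psi' (s x))).
Qed.

(** An operation [f x y = R x + L y] with [R], [L] affine permutations is
    brought to the standard form by moving the constants of [R] and [L] to [c];
    paramediality then compares the coefficients of [x]. *)
Lemma affine_op_of_affine (Z : zmodType) (f : Z -> Z -> Z) (R L : Z -> Z) :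
    bijective R -> bijective L -> (forall x y, f x y = R x + L y) ->
    (forall x y, R (x + y) + R 0 = R x + R y) ->
    (forall x y, L (x + y) + L 0 = L x + L y) ->
    (forall x y u v, f (f x y) (f u v) = f (f v y) (f u x)) ->
  exists (phi psi : Z -> Z) (c : Z),
    paramedial_pair phi psi /\ forall x y, f x y = affine_op phi psi c x y.
Proof.
move=> [r Rr rR] [l Ll lL] fE RD LD fM.
pose phi x := R x - R 0; pose psi x := L x - L 0.
have phiD : {morph phi : x y / x + y}.
  by move=> x y; rewrite /phi addrACA -RD addrA addrK.
have psiD : {morph psi : x y / x + y}.
  by move=> x y; rewrite /psi addrACA -LD addrA addrK.
have fA x y : f x y = affine_op phi psi (R 0 + L 0) x y.
  by rewrite /affine_op addrACA !subrK.
have phi_perm : additive_perm phi.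
  split=> //; exists (fun x => r (x + R 0)) => x.
    by rewrite /phi subrK Rr.
  by rewrite /phi rR addrK.
have psi_perm : additive_perm psi.
  split=> //; exists (fun x => l (x + L 0)) => x.
    by rewrite /psi subrK Ll.
  by rewrite /psi lL addrK.
clearbody phi psi; move: (R 0 + L 0) fA => c fA.
exists phi, psi, c; split=> //; split=> // x.
have phi0 := morph_add0 phiD; have psi0 := morph_add0 psiD.
have := fM x 0 0 0.
rewrite !fA /affine_op !phiD !psiD !(phi0, psi0) !(addr0, add0r).
by move/addIr; rewrite addrA => /addIr; rewrite [RHS]addrC => /addIr.
Qed.

End AffineOperations.

Section Structure.

Variables (T : finType) (f : T -> T -> T) (e : T).
Hypothesis fP : paramedial_quasigroup f.

(** Fix a point e and put R x = x * e and L y = e * y. The isotope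
    x + y = R^-1 x * L^-1 y is a loop with zero e * e, and
    x * y = R x + L y. In terms of + the paramedial law reads
    R (R x + L y) + L (R u + L v) = R (R v + L y) + L (R u + L x).
    Specialising some of the variables to e gives R (a + b) = R b + R (a + e)
    and L (c + d) = L (e + d) + L c; with these the law becomes
    (B + A) + (D + C) = (B + D) + (A + C) for arbitrary A, B, C, D, which makes
    the loop an abelian group, over which R and L are affine. *)
Theorem paramedial_affine :
  exists (Z : finZmodType) (phi psi : Z -> Z) (c : Z),
    [/\ #|Z| = #|T|, paramedial_pair phi psi & op_iso f (affine_op phi psi c)].
Proof.
case: fP => fl fr fM; case: (fl e) => l Ll lL; case: (fr e) => r Rr rR.
rewrite /= in Rr rR; pose R x := f x e; pose L := f e.
have {}Rr x : r (R x) = x by apply: Rr.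
have {}rR x : R (r x) = x by apply: rR.
have {}Ll x : l (L x) = x by apply: Ll.
have {}lL x : L (l x) = x by apply: lL.
pose add x y := f (r x) (l y); pose z := f e e.
have fE x y : f x y = add (R x) (L y) by rewrite /add Rr Ll.
have add0 x : add z x = x.
  by rewrite -{2}[x]lL -[z]/(R e) /add Rr.
have addz x : add x z = x.
  by rewrite -{2}[x]rR -[z]/(L e) /add Ll.
have Re : R e = z by []. have Le : L e = z by [].
have key x y u v : add (R (add (R x) (L y))) (L (add (R u) (L v))) =
   add (R (add (R v) (L y))) (L (add (R u) (L x))).
  by rewrite -!fE.
clearbody R L add z.
have shiftR a : L (add e (L (r a))) = R (add a e).
  have := key (r a) (l e) (r e) e.
  by rewrite !(rR, lL, Re, Le, addz, add0).
have RD a b : R (add a b) = add (R b) (R (add a e)).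
  have := key (r a) (l b) (r e) e.
  by rewrite !(rR, lL, Re, Le, addz, add0) shiftR.
have shiftL d : R (add (R (l d)) e) = L (add e d).
  have := key (l d) (l e) (r e) e.
  by rewrite !(rR, lL, Rr, Ll, Re, Le, addz, add0).
have LD c d : L (add c d) = add (L (add e d)) (L c).
  have := key (l d) (l e) (r c) e.
  by rewrite !(rR, lL, Rr, Ll, Re, Le, addz, add0) shiftL.
have medial A B C D : add (add B A) (add D C) = add (add B D) (add A C).
  have [a <-] : exists a, R (add a e) = A.
    case: (fr (l e)) => h _ hK; exists (R (h (r A))).
    by rewrite -[e]lL -fE hK rR.
  have [d <-] : exists d, L (add e d) = D.
    case: (fl (r e)) => h _ hK; exists (L (h (l D))).
    by rewrite -[e]rR -fE hK lL.
  have := key (r a) (l (r B)) (r (l C)) (l d).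
  rewrite !(rR, lL) RD LD rR lL => ->.
  by rewrite RD LD shiftR shiftL rR lL.
have addC : commutative add.
  by move=> x y; have := medial x z z y; rewrite !(addz, add0).
have addA : associative add.
  by move=> x y t; have := medial y x t z; rewrite !(addz, add0).
pose opp x := odflt z [pick y | add y x == z].
have addN : left_inverse z opp add.
  move=> x; rewrite /opp; case: pickP => [y /eqP //|/= no].
  case: (fr (l x)) => h _ hK; have := no (R (h z)).
  by rewrite -{1}[x]lL -fE hK eqxx.
pose Z : finZmodType := HB.pack_for finZmodType T (Finite.class T)
  (GRing.isZmodule.Build T addA addC add0 addN).
pose RZ : Z -> Z := R; pose LZ : Z -> Z := L; pose fZ : Z -> Z -> Z := f.
have addE (x y : Z) : (x + y)%R = add x y by [].
have RDZ (x y : Z) : (RZ (x + y) + RZ 0 = RZ x + RZ y)%R.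
  have E := RD x z; rewrite addz in E.
  by rewrite !addE /RZ E RD (addC (R y)) addC addA.
have LDZ (x y : Z) : (LZ (x + y) + LZ 0 = LZ x + LZ y)%R.
  have E := LD z y; rewrite add0 in E.
  by rewrite !addE /LZ E LD (addC _ (L x)) -addA.
have RZ_bij : bijective RZ by exists r.
have LZ_bij : bijective LZ by exists l.
have fZE x y : fZ x y = (RZ x + LZ y)%R by apply: fE.
have [phi [psi [c [pp fA]]]] :=
  @affine_op_of_affine Z fZ RZ LZ RZ_bij LZ_bij fZE RDZ LDZ fM.
have f_iso : op_iso f (affine_op phi psi c).
  exists (fun x : T => x : Z); [by exists id | exact: fA].
exists Z, phi, psi, c; split; last exact: f_iso; last exact: pp.
by case: f_iso => s /bij_eq_card.
Qed.
End Structure.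

(** * Cyclic groups of prime power order *)

Section Cyclic.
Local Open Scope ring_scope.

Variables (p k : nat).
Hypotheses (p_prime : prime p) (p_odd : odd p) (k_gt0 : (0 < k)%N).
Local Notation Zn := 'Z_(p ^ k).

Lemma pk_gt1 : (1 < p ^ k)%N.
Proof. by rewrite -(exp1n k) ltn_exp2r // prime_gt1. Qed.

Lemma ltn_Zn (c : Zn) : (c < p ^ k)%N.
Proof. by rewrite -[X in (_ < X)%N](Zp_cast pk_gt1) ltn_ord. Qed.

Lemma natr_Zn_eq0 m : (m%:R == 0 :> Zn) = (p ^ k %| m)%N.
Proof.
by rewrite -val_eqE /= (val_Zp_nat pk_gt1) /dvdn.
Qed.

Lemma natr_Zn_unit m : ((m%:R : Zn) \is a GRing.unit) = coprime p m.
Proof. by rewrite unitZpE ?pk_gt1 // coprime_pexpl. Qed.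

(** The ring of integers modulo p^k is local. *)
Lemma Zn_unit_add (x y : Zn) : x + y \is a GRing.unit ->
  (x \is a GRing.unit) || (y \is a GRing.unit).
Proof.
rewrite -[x]natr_Zp -[y]natr_Zp -natrD !natr_Zn_unit !prime_coprime //.
by apply: contraR; rewrite negb_or !negbK => /andP[px py]; apply: dvdn_add.
Qed.

Lemma Zn_2unit : (2 : Zn) \is a GRing.unit.
Proof. by rewrite natr_Zn_unit coprimen2. Qed.

(** The factors w - v and w + v of 0 add up to the unit 2 w, so one of them is
    a unit and the other one vanishes. *)
Lemma Zn_sqr_eq (w v : Zn) : w \is a GRing.unit -> w * w = v * v ->
  v = - w \/ v = w.
Proof.
move=> w_unit wv; have : (w - v) + (w + v) \is a GRing.unit.
  have -> : (w - v) + (w + v) = 2 * w by ring.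
  by rewrite unitrM Zn_2unit.
have e : (w - v) * (w + v) = 0.
  have -> : (w - v) * (w + v) = w * w - v * v by ring.
  by rewrite wv subrr.
case/Zn_unit_add/orP => u; [left|right].
  by apply: (addrI w); rewrite subrr; apply: (mulrI u); rewrite e mulr0.
by apply: (addIr (- v)); rewrite subrr; apply: (mulIr u); rewrite mul0r e.
Qed.

Lemma Zn_unit_ppow (c : Zn) : exists2 u : Zn, u \is a GRing.unit &
  exists2 a : nat, (a <= k)%N & c = u * p%:R ^+ a.
Proof.
have [c0|c_gt0] := posnP c.
  exists 1; rewrite ?unitr1 //; exists k => //; rewrite mul1r -natrX.
  rewrite -[c]natr_Zp c0; apply/eqP; rewrite eq_sym natr_Zn_eq0.
  exact: dvdnn.
have [m pm cm] := pfactor_coprime p_prime c_gt0.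
exists m%:R; first by rewrite natr_Zn_unit.
exists (logn p c); last by rewrite -natrX -natrM -cm natr_Zp.
rewrite leqNgt; apply/negP => ka.
have : (p ^ k %| c)%N by rewrite cm dvdn_mull // dvdn_exp2l // ltnW.
apply/negP; rewrite gtnNdvd //.
exact: ltn_Zn.
Qed.

Lemma additive_Zn (phi : Zn -> Zn) : additive_perm phi ->
  exists2 w, w \is a GRing.unit & forall x, phi x = w * x.
Proof.
move=> [[phi' _ phiK'] phiD].
have phiE x : phi x = phi 1 * x.
  by rewrite -{1}[x]natr_Zp (morph_addMn _ phiD) -mulr_natr natr_Zp.
exists (phi 1) => //; apply/unitrP; exists (phi' 1).
by rewrite mulrC -phiE phiK'.
Qed.

Lemma mulr_additive_perm (w : Zn) : w \is a GRing.unit ->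
  additive_perm ( *%R w).
Proof.
move=> uw; split=> [|x y]; last exact: mulrDr.
by exists ( *%R w^-1) => x; rewrite ?mulKr ?mulVKr.
Qed.

(** Representatives on the cyclic group: a unit w stands for (w, - w, 0), and
    (w, i) stands for (w, w, p^i). The condition on (w, i) says that p^i divides
    1 - 2 w, in the form of an annihilator; the exponent i for which p^i
    generates the same ideal as 1 - 2 w represents the class of c = 0. *)
Definition cyclic_form : Type :=
  ({unit Zn} + {wi : {unit Zn} * 'I_k.+1 |
     ((1 - 2 * val wi.1) * p%:R ^+ (k - wi.2) == 0 :> Zn)%R})%type.
HB.instance Definition _ := Finite.on cyclic_form.

Definition cyclic_op (x : cyclic_form) : Zn -> Zn -> Zn :=
  match x with
  | inl w => affine_op ( *%R (val w)) ( *%R (- val w)) 0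
  | inr (exist wi _) =>
      affine_op ( *%R (val wi.1)) ( *%R (val wi.1)) (p%:R ^+ wi.2)
  end.

Lemma opposite_pair (w : Zn) : w \is a GRing.unit ->
  paramedial_pair ( *%R w) ( *%R (- w)).
Proof.
move=> uw; split=> [||x]; rewrite ?mulrA ?mulrNN //;
  by apply: mulr_additive_perm; rewrite ?unitrN.
Qed.

Lemma equal_pair (w : Zn) : w \is a GRing.unit ->
  paramedial_pair ( *%R w) ( *%R w).
Proof. by move=> uw; split=> [||x] //; apply: mulr_additive_perm. Qed.

Lemma cyclic_op_paramedial x : paramedial_quasigroup (cyclic_op x).
Proof.
case: x => [w|[[w i] wiP]] /=; apply: affine_op_paramedial.
  exact/opposite_pair/(valP w).
exact/equal_pair/(valP w).
Qed.

Lemma cyclic_iso w v c w' v' c' :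
    paramedial_pair ( *%R w) ( *%R v) -> paramedial_pair ( *%R w') ( *%R v') ->
  op_iso (affine_op ( *%R w) ( *%R v) c) (affine_op ( *%R w') ( *%R v') c') <->
  [/\ w = w', v = v' & exists2 a : Zn, a \is a GRing.unit &
      exists b, c' = a * c + (1 - w - v) * b].
Proof.
move=> pp pp'; rewrite (affine_op_isoP _ _ pp pp'); split.
  case=> al [b [al_perm alw alv alc]].
  have [a a_unit alE] := additive_Zn al_perm.
  have eqw x y : (forall z, al (x * z) = y * al z) -> x = y.
    by move/(_ 1); rewrite !alE !mulr1 mulrC => /(mulIr a_unit).
  split; rewrite ?(eqw _ _ alw) ?(eqw _ _ alv) //; exists a => //.
  exists b; rewrite -alE; apply: (addrI (w' * b + v' * b)); rewrite -alc; ring.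
case=> <- <- [a a_unit [b ->]]; exists ( *%R a), b; split.
- exact: mulr_additive_perm.
- by move=> x; rewrite mulrCA.
- by move=> x; rewrite mulrCA.
ring.
Qed.

Lemma ppow_eq0 j : (p%:R ^+ j == 0 :> Zn) = (k <= j)%N.
Proof.
by rewrite -natrX natr_Zn_eq0 dvdn_Pexp2l ?prime_gt1.
Qed.

(** Multiplying p^j = a p^i + (1 - 2 w) b by p^(k - j) kills the left-hand side
    and the last term, so p^(i + k - j) = 0, whence j <= i; the converse
    inequality holds by symmetry. *)
Lemma cyclic_op_inj x y : op_iso (cyclic_op x) (cyclic_op y) -> x = y.
Proof.
have opp_neq (w : {unit Zn}) : - val w <> val w.
  move=> e; have : 2 * val w \is a GRing.unit.
    by rewrite unitrM Zn_2unit (valP w).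
  by rewrite mulr_natl mulr2n -{1}e addNr unitr0.
have le_exp z t : op_iso (cyclic_op (inr z)) (cyclic_op (inr t)) ->
    (val z).1 = (val t).1 /\ ((val t).2 <= (val z).2)%N.
  case: z t => [[w i] /= wi] [[w' j] /= wj].
  case/cyclic_iso; try exact/equal_pair/valP.
  move=> /val_inj e _ [a a_unit [b eb]]; split=> //; subst w'.
  have := congr1 (fun x => x * p%:R ^+ (k - j)) eb.
  have ltjk : (j <= k)%N by rewrite -ltnS ltn_ord.
  rewrite -exprD subnKC // mulrDl (mulrAC _ b).
  have -> : 1 - val w - val w = 1 - 2 * val w by ring.
  have -> : (1 - 2 * val w) * p%:R ^+ (k - j) = 0 by apply/eqP.
  rewrite mul0r addr0 -mulrA -exprD.
  have /eqP-> : (p%:R ^+ k == 0 :> Zn) by rewrite ppow_eq0.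
  move=> /esym/eqP; rewrite -(mulr0 a) (inj_eq (mulrI a_unit)) ppow_eq0.
  lia.
case: x y => [w|x] [w'|y] xy.
- case/cyclic_iso: xy => [||e _ _]; try exact/opposite_pair/valP.
  by rewrite (val_inj e).
- case: y xy => [[w' i] wi] /= /cyclic_iso[||e e' _].
  + exact/opposite_pair/valP.
  + exact/equal_pair/valP.
  by case: (opp_neq w); apply: etrans e' (esym e).
- case: x xy => [[w i] wi] /= /cyclic_iso[||e e' _].
  + exact/equal_pair/valP.
  + exact/opposite_pair/valP.
  by case: (opp_neq w'); apply: etrans (esym e') e.
have [e1 le1] := le_exp _ _ xy; have [_ le2] := le_exp _ _ (op_iso_sym xy).
congr (inr _); apply: val_inj; apply/eqP; rewrite -pair_eqE /= e1 eqxx /=.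
by rewrite -val_eqE eqn_leq le1 le2.
Qed.

(** For psi = w, write 1 - 2 w and c as units times p^d and p^e: scaling brings
    c to p^e if e <= d, and a translation brings it to p^d otherwise. *)
Lemma cyclic_op_surj (phi psi : Zn -> Zn) c : paramedial_pair phi psi ->
  exists x, op_iso (affine_op phi psi c) (cyclic_op x).
Proof.
case=> /additive_Zn[w w_unit phiE] /additive_Zn[v v_unit psiE] pp.
have {}pp : w * w = v * v by have := pp 1; rewrite !phiE !psiE !mulr1.
suff [x wvx] : exists x,
    op_iso (affine_op ( *%R w) ( *%R v) c) (cyclic_op x).
  exists x; apply: op_iso_trans wvx; exists id; first by exists id.
  by move=> a b; rewrite /affine_op phiE psiE.
case: (Zn_sqr_eq w_unit pp) => ->.
  exists (inl (FinRing.unit Zn w_unit)) => /=.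
  apply/cyclic_iso; try exact: opposite_pair.
  split=> //; exists 1; rewrite ?unitr1 //; exists (- c); ring.
have [u u_unit [d dk wd]] := Zn_unit_ppow (1 - 2 * w).
have [u' u'_unit [e ek cE]] := Zn_unit_ppow c.
have mk : (minn d e < k.+1)%N by rewrite ltnS geq_min dk.
have valid : (1 - 2 * val (FinRing.unit Zn w_unit)) *
    p%:R ^+ (k - Ordinal mk) == 0 :> Zn.
  rewrite /= wd -mulrA -exprD -(mulr0 u) (inj_eq (mulrI u_unit)) ppow_eq0.
  lia.
exists (inr (exist _ (FinRing.unit Zn w_unit, Ordinal mk) valid)) => /=.
apply/cyclic_iso; try exact: equal_pair.
split=> //; have -> : 1 - w - w = 1 - 2 * w by ring.
rewrite wd cE; case: (leqP e d) => [le_ed|lt_de].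
  exists u'^-1; rewrite ?unitrV //; exists 0.
  by rewrite mulKr // mulr0 addr0.
exists 1; rewrite ?unitr1 //; exists (u^-1 * (1 - u' * p%:R ^+ (e - d))).
rewrite mul1r [u * _]mulrC -mulrA mulVKr // mulrBr mulr1 mulrCA -exprD.
by rewrite subnKC ?(ltnW lt_de) // addrC subrK.
Qed.

Lemma card_Zn : #|Zn| = (p ^ k)%N.
Proof. by rewrite card_ord Zp_cast ?pk_gt1. Qed.

Lemma card_ppow_torsion i : (i <= k)%N ->
  #|[set y : Zn | y * p%:R ^+ (k - i) == 0]| = (p ^ (k - i))%N.
Proof.
move=> ik; have pi_gt0 : (0 < p ^ i)%N by rewrite expn_gt0 prime_gt0.
pose f (j : 'I_(p ^ (k - i))) : Zn := (j * p ^ i)%:R.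
have f_inj : injective f.
  move=> j j' /(congr1 val) /=; rewrite !(val_Zp_nat pk_gt1) !modn_small.
  - by move/eqP; rewrite eqn_pmul2r // => /eqP/val_inj.
  - by rewrite -[X in (_ < p ^ X)%N](subnK ik) expnD ltn_pmul2r.
  - by rewrite -[X in (_ < p ^ X)%N](subnK ik) expnD ltn_pmul2r.
rewrite -[RHS]card_ord -cardsT -(card_imset _ f_inj); congr #|pred_of_set _|.
apply/setP=> y; rewrite inE; apply/idP/imsetP => [|[j _ ->]]; last first.
  rewrite /f natrM natrX -mulrA -exprD subnKC //.
  have /eqP-> : (p%:R ^+ k == 0 :> Zn) by rewrite ppow_eq0.
  by rewrite mulr0.
rewrite -{1}[y]natr_Zp -natrX -natrM natr_Zn_eq0 -{1}(subnKC ik) expnD.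
rewrite dvdn_pmul2r ?expn_gt0 ?prime_gt0 // => /dvdnP[j yj].
have jlt : (j < p ^ (k - i))%N.
  rewrite -(ltn_pmul2r pi_gt0) -yj -expnD subnK //.
  exact: ltn_Zn.
by exists (Ordinal jlt) => //; rewrite /f /= -yj natr_Zp.
Qed.

(** For i = 0 every unit w is allowed. For i > 0 the map w |-> 1 - 2 w is onto
    the p^(k-i) multiples of p^i: if y is such a multiple then 1 - y is a unit,
    hence of the form 2 w. *)
Lemma card_cyclic_form :
  #|{: cyclic_form}| =
  ((totient (p ^ k)).*2 + \sum_(1 <= i < k.+1) p ^ (k - i))%N.
Proof.
have cU : #|{: {unit Zn}}| = totient (p ^ k).
  by rewrite -card_units_Zp ?cardsT // ltnW ?pk_gt1.
rewrite [LHS]card_sum cU card_sig -addnn -addnA; congr (_ + _)%N.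
pose valid (w : {unit Zn}) (i : nat) :=
  (1 - 2 * val w) * p%:R ^+ (k - i) == 0.
have -> : #|[pred wi : {unit Zn} * 'I_k.+1 | valid wi.1 wi.2]| =
    (\sum_(i < k.+1) #|[pred w | valid w i]|)%N.
  rewrite -sum1_card big_mkcond /=.
  rewrite -(pair_bigA _ (fun w (i : 'I_k.+1) => if valid w i then 1%N else 0%N)).
  rewrite exchange_big; apply: eq_bigr => i _ /=.
  by rewrite -big_mkcond sum1_card.
rewrite big_ord_recl; congr (_ + _)%N.
  rewrite -cU; apply: eq_card => w; rewrite !inE /valid subn0.
  have /eqP-> : (p%:R ^+ k == 0 :> Zn) by rewrite ppow_eq0.
  by rewrite mulr0 eqxx.
rewrite big_add1 /= big_mkord; apply: eq_bigr => i _ /=.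
rewrite -card_ppow_torsion //.
have f_inj : injective (fun w : {unit Zn} => 1 - 2 * val w).
  by move=> w w' /(can_inj (subKr 1))/(mulrI Zn_2unit)/val_inj.
rewrite -(card_imset _ f_inj); congr #|pred_of_set _|.
apply/setP=> y; rewrite inE; apply/imsetP/idP => [[w]|y_tors].
  by rewrite inE => w_valid ->.
have y1_unit : 1 - y \is a GRing.unit.
  have := @Zn_unit_add y (1 - y); rewrite [y + _]addrC subrK unitr1.
  case/(_ isT)/orP => // y_unit; move: y_tors.
  rewrite -{1}(mulr0 y) (inj_eq (mulrI y_unit)) ppow_eq0; lia.
have w_unit : 2^-1 * (1 - y) \is a GRing.unit.
  by rewrite unitrM unitrV Zn_2unit.
exists (FinRing.unit Zn w_unit) => /=; last by rewrite mulVKr ?Zn_2unit // subKr.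
by rewrite inE /valid /= mulVKr ?Zn_2unit // subKr.
Qed.

End Cyclic.

(** * Abelian groups of order p and p^2 *)

Section Groups.

Lemma cyclic_zmod (Z : finZmodType) n (x : Z) : (1 < n)%N -> #|Z| = n ->
  #[x]%g = n -> exists s : 'Z_n -> Z, additive_perm s.
Proof.
move=> n_gt1 Zn xn; pose s (i : 'Z_n) := (x *+ i)%R.
have s_eq i j : (x *+ i == x *+ j)%R = (i == j %[mod n]).
  by rewrite -!zmodXgE eq_expg_mod_order xn.
exists s; split.
  apply: inj_card_bij => [i j /eqP|]; last first.
    by rewrite Zn card_ord Zp_cast.
  have ltn (a : 'Z_n) : (a < n)%N by rewrite -[X in (_ < X)%N](Zp_cast n_gt1) ltn_ord.
  by rewrite s_eq !modn_small // => /eqP/val_inj.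
move=> i j; rewrite /s -mulrnDr; apply/eqP; rewrite s_eq.
have -> : nat_of_ord (i + j)%R = ((i + j) %% n)%N.
  by congr (_ %% _)%N; apply: Zp_cast.
by rewrite modn_mod.
Qed.

(** A group of order p^2 that is killed by p is an elementary abelian p-group
    of rank 2. *)
Lemma elementary_zmod (Z : finZmodType) p : prime p -> #|Z| = (p ^ 2)%N ->
  (forall x : Z, x *+ p = 0)%R ->
  exists s : 'rV['F_p]_2 -> Z, additive_perm s.
Proof.
move=> p_prime Zp2 Zp.
have abelZ : (p.-abelem [set: Z])%g.
  rewrite abelemE // zmod_abelian; apply/exponentP=> x _.
  by rewrite zmodXgE Zp.
have ntZ : ([set: Z] != 1)%g.
  by rewrite -cardG_gt1 cardsT Zp2 (ltn_exp2l 0) // prime_gt1.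
suff: exists s : 'rV['F_p]_('dim [set: Z])%g -> Z, additive_perm s.
  by rewrite (dim_abelemE abelZ ntZ) cardsT Zp2 pfactorK.
exists (rVabelem abelZ ntZ); split.
  apply: inj_card_bij; first exact: rVabelem_inj.
  rewrite card_mx mul1n card_Fp // (dim_abelemE abelZ ntZ) cardsT Zp2 pfactorK //.
by move=> u v; rewrite rVabelemD.
Qed.

Lemma zmod_prime (Z : finZmodType) p : prime p -> #|Z| = p ->
  exists s : 'Z_p -> Z, additive_perm s.
Proof.
move=> p_prime Zp; have p_gt1 := prime_gt1 p_prime.
have : (1 < #|[set: Z]|)%N by rewrite cardsT Zp.
rewrite cardG_gt1 => /trivgPn[x _ x_neq1]; apply: (@cyclic_zmod _ _ x) => //.
apply/prime_nt_dvdP => //; first by rewrite order_eq1.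
by rewrite -Zp -cardsT order_dvdG ?in_setT.
Qed.

Lemma zmod_prime_square (Z : finZmodType) p : prime p -> #|Z| = (p ^ 2)%N ->
  (exists s : 'Z_(p ^ 2) -> Z, additive_perm s) \/
  (exists s : 'rV['F_p]_2 -> Z, additive_perm s).
Proof.
move=> p_prime Zp2; have p_gt1 := prime_gt1 p_prime.
have [[x /eqP xp2]|no_x] := altP (@existsP Z (fun x => #[x]%g == p ^ 2)%N).
  by left; apply: (@cyclic_zmod _ _ x) => //; rewrite (ltn_exp2l 0).
right; apply: elementary_zmod => // x.
apply/eqP; rewrite -zmodXgE -[_ == _]/(_ == 1%g) -order_dvdn.
have : (#[x]%g %| p ^ 2)%N by rewrite -Zp2 -cardsT order_dvdG ?in_setT.
case/(dvdn_pfactor _ _ p_prime) => [[|[|[|//]]]] // _ xE.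
- by rewrite xE dvd1n.
- by rewrite xE.
by case/existsP: no_x; exists x; rewrite xE.
Qed.
End Groups.

(** * Two by two matrices *)

Section Matrix2.
Local Open Scope ring_scope.
Variable F : fieldType.
Implicit Types (u v g : 'M[F]_2) (e f : 'rV[F]_2).

Definition mx2 (a b c d : F) : 'M[F]_2 :=
  \matrix_(i, j) if i == 0 then (if j == 0 then a else b)
                 else (if j == 0 then c else d).

Lemma matrix2P u v :
  u = v <-> [/\ u 0 0 = v 0 0, u 0 1 = v 0 1, u 1 0 = v 1 0 & u 1 1 = v 1 1].
Proof.
split=> [->//|[e00 e01 e10 e11]]; apply/matrixP => i j.
case: (unliftP 0 i) => [i'|] ->; case: (unliftP 0 j) => [j'|] ->;
  rewrite ?(ord1 i') ?(ord1 j') //.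
- by have -> : lift 0 0 = 1 :> 'I_2 by apply: val_inj.
- by have -> : lift 0 0 = 1 :> 'I_2 by apply: val_inj.
by have -> : lift 0 0 = 1 :> 'I_2 by apply: val_inj.
Qed.

Lemma mx2E u : u = mx2 (u 0 0) (u 0 1) (u 1 0) (u 1 1).
Proof. by apply/matrix2P; rewrite !mxE. Qed.

Lemma mx2_eq a b c d a' b' c' d' :
  mx2 a b c d = mx2 a' b' c' d' <-> [/\ a = a', b = b', c = c' & d = d'].
Proof. by rewrite matrix2P !mxE. Qed.

Lemma mx2M a b c d a' b' c' d' :
  mx2 a b c d *m mx2 a' b' c' d' =
  mx2 (a * a' + b * c') (a * b' + b * d') (c * a' + d * c') (c * b' + d * d').
Proof.
apply/matrix2P; rewrite !mxE !big_ord_recl !big_ord0 !mxE /=.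
by split; rewrite addr0.
Qed.

Lemma mx2D a b c d a' b' c' d' :
  mx2 a b c d + mx2 a' b' c' d' = mx2 (a + a') (b + b') (c + c') (d + d').
Proof. by apply/matrix2P; rewrite !mxE. Qed.

Lemma mx2N a b c d : - mx2 a b c d = mx2 (- a) (- b) (- c) (- d).
Proof. by apply/matrix2P; rewrite !mxE. Qed.

Lemma mx2Z k a b c d : k *: mx2 a b c d = mx2 (k * a) (k * b) (k * c) (k * d).
Proof. by apply/matrix2P; rewrite !mxE. Qed.

Lemma mx2_scalar a : a%:M = mx2 a 0 0 a.
Proof. by apply/matrix2P; rewrite !mxE. Qed.

Lemma mx2_0 : 0 = mx2 0 0 0 0.
Proof. by apply/matrix2P; rewrite !mxE. Qed.

Lemma mx2_tr a b c d : \tr (mx2 a b c d) = a + d.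
Proof. by rewrite /mxtrace !big_ord_recl big_ord0 !mxE /= addr0. Qed.

Lemma mx2_det a b c d : \det (mx2 a b c d) = a * d - b * c.
Proof.
rewrite (expand_det_row _ 0) !big_ord_recl big_ord0 /cofactor !det_mx11 !mxE /=.
by ring.
Qed.

Lemma mx2_unit a b c d : (mx2 a b c d \in unitmx) = (a * d - b * c != 0).
Proof. by rewrite unitmxE mx2_det unitfE. Qed.

Lemma Cayley_Hamilton2 u : u *m u = \tr u *: u - (\det u)%:M.
Proof.
rewrite (mx2E u); move: (u 0 0) (u 0 1) (u 1 0) (u 1 1) => a b c d.
rewrite mx2_tr mx2_det mx2M mx2Z mx2_scalar mx2N mx2D.
by apply/mx2_eq; split; ring.
Qed.

(** The change of basis to (e, f), since matrices act on row vectors from the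
    right. *)
Definition basis2 e f : 'M[F]_2 := \matrix_i (if i == 0 then e else f).

Lemma basis2E e f : basis2 e f = mx2 (e 0 0) (e 0 1) (f 0 0) (f 0 1).
Proof. by apply/matrix2P; rewrite !mxE. Qed.

Lemma basis2M e f u : basis2 e f *m u = basis2 (e *m u) (f *m u).
Proof.
apply/row_matrixP => i; rewrite row_mul !rowK; by case: (i == 0).
Qed.

Lemma mx2_basis a b c d e f :
  mx2 a b c d *m basis2 e f = basis2 (a *: e + b *: f) (c *: e + d *: f).
Proof. by rewrite !basis2E mx2M !mxE. Qed.

Lemma row2P e f : e = f <-> e 0 0 = f 0 0 /\ e 0 1 = f 0 1.
Proof.
split=> [->//|[e0 e1]].
have : basis2 e 0 = basis2 f 0 by rewrite !basis2E e0 e1.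
by move/(congr1 (row 0)); rewrite !rowK.
Qed.

Lemma basis2_unit e f :
  f != 0 -> (forall k, e != k *: f) -> basis2 e f \in unitmx.
Proof.
move=> f0 ef; rewrite basis2E mx2_unit; apply: contraNneq f0 => det0.
have [f00|f00] := eqVneq (f 0 0) 0; last first.
  case/eqP: (ef (e 0 0 / f 0 0)); apply/row2P; rewrite !mxE divfK //; split=> //.
  apply: (mulfI f00); rewrite mulrA mulrCA divff // mulr1.
  by apply/eqP; rewrite eq_sym -subr_eq0 -[X in _ == X]det0; apply/eqP; ring.
have [f01|f01] := eqVneq (f 0 1) 0.
  by apply/eqP/row2P; rewrite !mxE f00 f01.
case/eqP: (ef (e 0 1 / f 0 1)); apply/row2P; rewrite !mxE divfK //; split=> //.
move: det0; rewrite f00 mulr0 subr0 mulr0 => /eqP.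
by rewrite mulf_eq0 (negPf f01) orbF => /eqP.
Qed.

Lemma basis2_coord e f (x : 'rV_2) : basis2 e f \in unitmx ->
  exists a b, x = a *: e + b *: f.
Proof.
move=> ef_unit; rewrite -[x](mulmxKV ef_unit); move: (x *m _) => y.
exists (y 0 0), (y 0 1); rewrite basis2E.
have e1 : lift ord0 ord0 = 1 :> 'I_2 by apply: val_inj.
by apply/row2P; rewrite !mxE !big_ord_recl !big_ord0 !mxE /= !e1 !addr0.
Qed.

Lemma nonzero_row u : u != 0 -> exists x : 'rV_2, x *m u != 0.
Proof.
move=> u0; have [i ui] : exists i, row i u != 0.
  apply/existsP; apply: contraNT u0 => /existsPn u0; apply/eqP/row_matrixP => i.
  by rewrite row0; apply/eqP; have := u0 i; rewrite negbK.
by exists (delta_mx 0 i); rewrite -rowE.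
Qed.

(** Simultaneous conjugacy, written without inverses. *)
Definition conj_pair (m m' : 'M[F]_2 * 'M[F]_2) :=
  exists2 g, g \in unitmx & g *m m.1 = m'.1 *m g /\ g *m m.2 = m'.2 *m g.

Lemma basis2_conj_pair e f a b c d a' b' c' d' u v :
    basis2 e f \in unitmx ->
    e *m u = a *: e + b *: f -> f *m u = c *: e + d *: f ->
    e *m v = a' *: e + b' *: f -> f *m v = c' *: e + d' *: f ->
  conj_pair (u, v) (mx2 a b c d, mx2 a' b' c' d').
Proof.
move=> ef_unit eu fu ev fv; exists (basis2 e f) => //=.
by rewrite !basis2M !mx2_basis eu fu ev fv.
Qed.

(** One of the two standard basis vectors is cyclic unless u is diagonal, and
    then their sum is cyclic unless u is scalar. *)
Lemma cyclic_vector u : (forall a, u != a%:M) ->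
  exists e, basis2 e (e *m u) \in unitmx.
Proof.
move=> u_nonscal; rewrite (mx2E u).
move: (u_nonscal (u 0 0)); rewrite {1}(mx2E u).
move: (u 0 0) (u 0 1) (u 1 0) (u 1 1) => a b c d abcd.
pose rw (x y : F) : 'rV[F]_2 := \row_j (if j == 0 then x else y).
have rwM (x y : F) : rw x y *m mx2 a b c d = rw (x * a + y * c) (x * b + y * d).
  by apply/row2P; rewrite !mxE !big_ord_recl !big_ord0 !mxE /= !addr0.
have rwU (x y x' y' : F) : basis2 (rw x y) (rw x' y') \in unitmx = (x * y' - y * x' != 0).
  by rewrite basis2E !mxE mx2_unit.
have [b0|b0] := eqVneq b 0; last first.
  by exists (rw 1 0); rewrite rwM rwU !(mul1r, mul0r, addr0, subr0).
have [c0|c0] := eqVneq c 0; last first.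
  by exists (rw 0 1); rewrite rwM rwU !(mul1r, mul0r, add0r, sub0r) oppr_eq0.
exists (rw 1 1); rewrite rwM rwU b0 c0 !(mul1r, addr0, add0r) subr_eq0.
apply: contraNneq abcd => da; rewrite b0 c0 da mx2_scalar; exact/eqP.
Qed.

End Matrix2.

(** * Anticommuting pairs of matrices up to conjugacy *)

Section NormalForms.
Local Open Scope ring_scope.
Variable F : finFieldType.
Hypothesis F2 : 2 != 0 :> F.
Implicit Types (u v g : 'M[F]_2) (e f : 'rV[F]_2).

(** Names of the conjugacy classes of pairs (u, v) with u v = - v u and u + v,
    u - v invertible. Either one of u, v is zero and the other one is scalar or
    a companion matrix; or u v = 0 with u and v nonzero; or u v <> 0, and then
    u^2 and v^2 are scalars a, b, the cases a = 0 and b = 0 being those of a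
    nilpotent u or v. With a, b nonzero, u and v generate the quaternion
    algebra (a, b). *)
Inductive normal_form :=
  | ScalarU of F | CompanionU of F & F
  | ScalarV of F | CompanionV of F & F
  | Diagonal of F & F
  | NilpotentU of F | NilpotentV of F
  | Quaternionic of F & F.

Definition nf_code (x : normal_form) :
    ((F + F * F) + (F + F * F)) + (F * F + (F + F + F * F)) :=
  match x with
  | ScalarU a => inl (inl (inl a))
  | CompanionU t d => inl (inl (inr (t, d)))
  | ScalarV a => inl (inr (inl a))
  | CompanionV t d => inl (inr (inr (t, d)))
  | Diagonal t s => inr (inl (t, s))
  | NilpotentU a => inr (inr (inl (inl a)))
  | NilpotentV a => inr (inr (inl (inr a)))
  | Quaternionic a b => inr (inr (inr (a, b)))
  end.

Definition nf_decode x : normal_form :=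
  match x with
  | inl (inl (inl a)) => ScalarU a
  | inl (inl (inr (t, d))) => CompanionU t d
  | inl (inr (inl a)) => ScalarV a
  | inl (inr (inr (t, d))) => CompanionV t d
  | inr (inl (t, s)) => Diagonal t s
  | inr (inr (inl (inl a))) => NilpotentU a
  | inr (inr (inl (inr a))) => NilpotentV a
  | inr (inr (inr (a, b))) => Quaternionic a b
  end.

Lemma nf_codeK : cancel nf_code nf_decode.
Proof. by case. Qed.

Lemma nf_decodeK : cancel nf_decode nf_code.
Proof. by case=> [[[]|[]]|[|[[]|]]] => // -[]. Qed.

HB.instance Definition _ := Finite.copy normal_form (can_type nf_codeK).

Definition nf_valid (x : normal_form) : bool :=
  match x with
  | ScalarU a | ScalarV a | NilpotentU a | NilpotentV a => a != 0
  | CompanionU _ d | CompanionV _ d => d != 0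
  | Diagonal t s => (t != 0) && (s != 0)
  | Quaternionic a b => [&& a != 0, b != 0 & a + b != 0]
  end.

(** A point (s, r) of the conic [s ^+ 2 = a + b * r ^+ 2], which has one as soon
    as b is nonzero ([conic_pointP]); a point of this conic is what splits the
    quaternion algebra (a, b). *)
Definition conic_point (a b : F) : F * F :=
  odflt (0, 0) [pick sr | sr.1 ^+ 2 == a + b * sr.2 ^+ 2].

(** In the quaternionic case the basis is (e, e v), where e is an eigenvector of
    u + r v with eigenvalue s, so that e u = s e - r e v. *)
Definition nf_pair (x : normal_form) : 'M[F]_2 * 'M[F]_2 :=
  match x with
  | ScalarU a => (a%:M, 0)
  | CompanionU t d => (mx2 0 1 (- d) t, 0)
  | ScalarV a => (0, a%:M)
  | CompanionV t d => (0, mx2 0 1 (- d) t)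
  | Diagonal t s => (mx2 t 0 0 0, mx2 0 0 0 s)
  | NilpotentU a => (mx2 0 1 0 0, mx2 a 0 0 (- a))
  | NilpotentV a => (mx2 a 0 0 (- a), mx2 0 1 0 0)
  | Quaternionic a b => let: (s, r) := conic_point a b in
      (mx2 s (- r) (r * b) (- s), mx2 0 1 b 0)
  end.

(** The condition on u = (phi + psi) / 2 and v = (phi - psi) / 2 that expresses
    phi^2 = psi^2, for invertible phi and psi. *)
Definition anticommuting_pair (m : 'M[F]_2 * 'M[F]_2) :=
  [/\ m.1 *m m.2 = - (m.2 *m m.1), m.1 + m.2 \in unitmx & m.1 - m.2 \in unitmx].

(** Each nonzero square has at most two roots and zero has only one. *)
Lemma card_squares : (#|F| < (#|[set x ^+ 2 | x : F]|).*2)%N.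
Proof.
set S := [set x ^+ 2 | x : F].
have fib (y : F) : (#|[set x : F | x ^+ 2 == y]| <= 2 - (y == 0%R))%N.
  case: (pickP [pred x : F | x ^+ 2 == y]) => [x /= /eqP <-|none]; last first.
    by rewrite (_ : [set x | _] = set0) ?cards0 //; apply/setP=> x; have /= := none x; rewrite !inE.
  have -> : [set z | z ^+ 2 == x ^+ 2] = [set x; - x].
    by apply/setP=> z; rewrite !inE eqf_sqr.
  rewrite cards2 sqrf_eq0; case: (eqVneq x 0) => [->|_]; rewrite ?oppr0 ?eqxx //.
  by case: (_ != _).
have -> : #|F| = (\sum_(y in S) #|[set x : F | x ^+ 2 == y]|)%N.
  rewrite -sum1_card (partition_big (fun x : F => x ^+ 2) (mem S)) /=.
    by apply: eq_bigr => y _; rewrite -sum1_card; apply: eq_bigl => x; rewrite inE.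
  by move=> x _; apply: imset_f.
have S0 : 0 \in S by apply/imsetP; exists 0; rewrite ?expr0n.
rewrite (bigD1 0) //= (cardsD1 0 S) S0 doubleD.
apply: (@leq_trans (1 + (1 + \sum_(y in S :\ 0%R) 2))%N); last first.
  by rewrite sum_nat_const muln2.
rewrite ltnS leq_add //; first by have := fib 0; rewrite eqxx.
rewrite [leqLHS](eq_bigl (mem (S :\ 0))); last by move=> y; rewrite !inE andbC.
by apply: leq_sum => y _; apply: leq_trans (fib y) _; rewrite leq_subr.
Qed.

(** The values of s^2 and those of a + b r^2 both fill more than half of the
    field, so they meet. *)
Lemma conic_pointP a b : b != 0 ->
  (conic_point a b).1 ^+ 2 = a + b * (conic_point a b).2 ^+ 2.
Proof.
move=> b0; rewrite /conic_point; case: pickP => [[s r] /= /eqP //|none].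
pose S := [set x ^+ 2 | x : F]; pose S' := [set a + b * x | x in S].
have S'S : (#|S'| = #|S|) by apply: card_imset => x y /addrI/(mulfI b0).
have : [disjoint S & S'].
  apply/pred0P => y /=; apply/negP => /andP[/imsetP[s _ ->]].
  case/imsetP=> _ /imsetP[r _ ->] e; have := none (s, r).
  by rewrite /= e eqxx.
move=> /disjoint_setI0 SS'; have := cardsUI S S'.
rewrite SS' cards0 addn0 S'S addnn => e.
have := max_card (mem (S :|: S')); rewrite e leqNgt.
by rewrite card_squares.
Qed.

Lemma cyclic_or_scalar u : u \in unitmx ->
  (exists2 a, a != 0 & u = a%:M) \/
  (exists t d e, [/\ d != 0, basis2 e (e *m u) \in unitmx &
     e *m u *m u = - d *: e + t *: (e *m u)]).
Proof.
move=> u_unit; have [/existsP[a /eqP ua]|/existsPn u_nscal] :=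
  boolP [exists a, u == a%:M].
  left; exists a => //; apply: contraTneq u_unit => a0.
  by rewrite ua a0 mx2_scalar mx2_unit mulr0 subr0 eqxx.
right; have [e e_unit] := cyclic_vector u_nscal.
have [d [t euu]] := basis2_coord (e *m u *m u) e_unit.
exists t, (- d), e; rewrite opprK; split=> //.
rewrite oppr_eq0; apply: contraTneq u_unit => d0.
have : basis2 e (e *m u) *m u = mx2 0 1 d t *m basis2 e (e *m u).
  by rewrite basis2M mx2_basis euu scale0r scale1r add0r.
move/(congr1 (fun m : 'M_2 => m \in unitmx)); rewrite !unitmx_mul e_unit andbT andTb.
by rewrite mx2_unit mul0r mul1r d0 subr0 eqxx => ->.
Qed.

Lemma classify_v0 u : u \in unitmx ->
  exists2 x, nf_valid x & conj_pair (u, 0) (nf_pair x).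
Proof.
case/cyclic_or_scalar => [[a a0 ->]|[t [d [e [d0 e_unit euu]]]]].
  exists (ScalarU a) => //; exists 1%:M; first exact: unitmx1.
  by rewrite /= !mul1mx !mulmx1.
exists (CompanionU t d) => //=; rewrite mx2_0.
by apply: (basis2_conj_pair e_unit); rewrite -?mx2_0 ?mulmx0 ?scale0r ?scale1r ?add0r.
Qed.

Lemma classify_u0 v : v \in unitmx ->
  exists2 x, nf_valid x & conj_pair (0, v) (nf_pair x).
Proof.
case/cyclic_or_scalar => [[a a0 ->]|[t [d [e [d0 e_unit euu]]]]].
  exists (ScalarV a) => //; exists 1%:M; first exact: unitmx1.
  by rewrite /= !mul1mx !mulmx1.
exists (CompanionV t d) => //=; rewrite mx2_0.
by apply: (basis2_conj_pair e_unit); rewrite -?mx2_0 ?mulmx0 ?scale0r ?scale1r ?add0r.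
Qed.

Lemma mulmx_neq0 e u : u \in unitmx -> e != 0 -> e *m u != 0.
Proof.
move=> u_unit; apply: contraNneq => eu0.
by rewrite -(mulmxK u_unit e) eu0 mul0mx.
Qed.

(** If u and v are nonzero with u v = v u = 0, their images are two lines, each
    one the kernel of the other matrix; vectors e, f on them form a basis. *)
Lemma classify_split u v : u != 0 -> v != 0 -> u *m v = 0 -> v *m u = 0 ->
    u + v \in unitmx ->
  exists2 x, nf_valid x & conj_pair (u, v) (nf_pair x).
Proof.
move=> /nonzero_row[x xu0] /nonzero_row[y yv0] uv0 vu0 uv_unit.
pose e := x *m u; pose f := y *m v.
have ev0 : e *m v = 0 by rewrite -mulmxA uv0 mulmx0.
have fu0 : f *m u = 0 by rewrite -mulmxA vu0 mulmx0.
have eu_neq0 : e *m u != 0.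
  by have := mulmx_neq0 uv_unit xu0; rewrite mulmxDr ev0 addr0.
have fv_neq0 : f *m v != 0.
  by have := mulmx_neq0 uv_unit yv0; rewrite mulmxDr fu0 add0r.
have ef_unit : basis2 e f \in unitmx.
  apply: basis2_unit => // k; apply: contraNneq eu_neq0 => ->.
  by rewrite -scalemxAl fu0 scaler0.
have [t [b eu]] := basis2_coord (e *m u) ef_unit.
have [c [s fv]] := basis2_coord (f *m v) ef_unit.
have b0 : b = 0.
  have : e *m u *m v = 0 by rewrite -mulmxA uv0 mulmx0.
  rewrite eu mulmxDl -!scalemxAl ev0 scaler0 add0r => /eqP.
  by rewrite scaler_eq0 (negPf fv_neq0) orbF => /eqP.
have c0 : c = 0.
  have : f *m v *m u = 0 by rewrite -mulmxA vu0 mulmx0.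
  rewrite fv mulmxDl -!scalemxAl fu0 scaler0 addr0 => /eqP.
  by rewrite scaler_eq0 (negPf eu_neq0) orbF => /eqP.
rewrite b0 in eu; rewrite c0 in fv.
exists (Diagonal t s) => /=; last first.
  apply: (basis2_conj_pair ef_unit) => //.
    by rewrite fu0 !scale0r addr0.
  by rewrite ev0 !scale0r addr0.
apply/andP; split.
  by apply: contraNneq eu_neq0 => t0; rewrite eu t0 !scale0r addr0.
by apply: contraNneq fv_neq0 => t0; rewrite fv t0 !scale0r addr0.
Qed.

(** Anticommuting with v, u has a square that commutes with v; by the
    Cayley-Hamilton identity so does (tr u) u, and then u v = v u = - u v unless
    tr u = 0. *)
Lemma anticomm_trace0 u v : u *m v = - (v *m u) -> u *m v != 0 -> \tr u = 0.
Proof.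
move=> uv uv0; apply/eqP; apply: contraNT uv0 => tr0.
have sq_comm : u *m u *m v = v *m (u *m u).
  by rewrite -mulmxA uv mulmxN (mulmxA u v u) uv mulNmx opprK mulmxA.
move: sq_comm; rewrite Cayley_Hamilton2 mulmxBl mulmxBr scalar_mxC.
move/addIr; rewrite -scalemxAl -scalemxAr uv => /(scalerI tr0).
move/eqP; rewrite eq_sym -addr_eq0 -mulr2n -scaler_nat scaler_eq0 (negPf F2) /=.
by move/eqP->; rewrite oppr0.
Qed.

Lemma trace0_square u : \tr u = 0 -> u *m u = (- \det u)%:M.
Proof. by move=> tr0; rewrite Cayley_Hamilton2 tr0 scale0r sub0r raddfN. Qed.

(** Take x with f = x u nonzero. As v maps the kernel of u to itself, f is an
    eigenvector of v; the matrix of v in (x, f) is triangular with eigenvalues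
    a and - a, and adding a multiple of f to x makes it diagonal. *)
Lemma nilpotent_basis u v : u != 0 -> u *m u = 0 -> u *m v = - (v *m u) ->
    v \in unitmx ->
  exists a e f, [/\ a != 0, basis2 e f \in unitmx, e *m u = f, f *m u = 0 &
    e *m v = a *: e /\ f *m v = - a *: f].
Proof.
move=> /nonzero_row[x xu0] uu uv v_unit; pose f := x *m u.
have fu : f *m u = 0 by rewrite -mulmxA uu mulmx0.
have xf_unit k : basis2 (x + k *: f) f \in unitmx.
  apply: basis2_unit => // h; apply: contraNneq xu0 => xhf.
  have : (x + k *: f) *m u = 0 by rewrite xhf -scalemxAl fu scaler0.
  by rewrite mulmxDl -scalemxAl fu scaler0 addr0 => ->.
have xf0 : basis2 x f \in unitmx by have := xf_unit 0; rewrite scale0r addr0.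
have [a [b xv]] := basis2_coord (x *m v) xf0.
have fv : f *m v = - a *: f.
  rewrite -mulmxA uv mulmxN mulmxA xv mulmxDl -!scalemxAl fu scaler0 addr0.
  by rewrite scaleNr.
have a0 : a != 0.
  have : f *m v != 0 by apply: mulmx_neq0.
  by apply: contraNneq => a0; rewrite fv a0 oppr0 scale0r.
exists a, (x + (b / (2 * a)) *: f), f; split=> //.
  by rewrite mulmxDl -scalemxAl fu scaler0 addr0.
split=> //; rewrite mulmxDl -scalemxAl xv fv -addrA scalerDr; congr (_ + _).
rewrite !scalerA -scalerDl; congr (_ *: _).
by field; rewrite a0.
Qed.

Lemma classify_nilpotentU u v : u != 0 -> u *m u = 0 -> u *m v = - (v *m u) ->
    v \in unitmx -> exists2 x, nf_valid x & conj_pair (u, v) (nf_pair x).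
Proof.
move=> u0 uu uv v_unit.
have [a [e [f [a0 ef eu fu [ev fv]]]]] := nilpotent_basis u0 uu uv v_unit.
exists (NilpotentU a) => //=; apply: (basis2_conj_pair ef).
- by rewrite scale0r add0r scale1r.
- by rewrite !scale0r add0r.
- by rewrite scale0r addr0.
by rewrite scale0r add0r.
Qed.

Lemma classify_nilpotentV u v : v != 0 -> v *m v = 0 -> u *m v = - (v *m u) ->
    u \in unitmx -> exists2 x, nf_valid x & conj_pair (u, v) (nf_pair x).
Proof.
move=> v0 vv uv u_unit; have vu : v *m u = - (u *m v) by rewrite uv opprK.
have [a [e [f [a0 ef ev fv [eu fu]]]]] := nilpotent_basis v0 vv vu u_unit.
exists (NilpotentV a) => //=; apply: (basis2_conj_pair ef).
- by rewrite scale0r addr0.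
- by rewrite scale0r add0r.
- by rewrite scale0r add0r scale1r.
by rewrite !scale0r add0r.
Qed.

Lemma scalar_square_unit u a : a != 0 -> u *m u = a%:M -> u \in unitmx.
Proof.
move=> a0 uu; have : u *m u \in unitmx.
  by rewrite uu mx2_scalar mx2_unit mulr0 subr0 mulf_neq0.
by rewrite unitmx_mul => /andP[].
Qed.

(** The square of z = u + r v is a + r^2 b = s^2, so z has an eigenvector e with
    eigenvalue s. It is no eigenvector of v, since it would be one of u as well
    while u and v commute on no nonzero vector; so (e, e v) is a basis. *)
Lemma classify_quaternion u v a b : a != 0 -> b != 0 ->
    u *m u = a%:M -> v *m v = b%:M -> u *m v = - (v *m u) ->
  conj_pair (u, v) (nf_pair (Quaternionic a b)).
Proof.
move=> a0 b0 uu vv uv.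
have := conic_pointP a b0; rewrite /=; case: (conic_point a b) => s r /= sr.
have u_unit := scalar_square_unit a0 uu.
have v_unit := scalar_square_unit b0 vv.
have not_comm e : e != 0 -> e *m u *m v != e *m v *m u.
  move=> e0; apply: contraNneq (mulmx_neq0 v_unit (mulmx_neq0 u_unit e0)) => uv_vu.
  have : e *m u *m v = - (e *m u *m v) by rewrite {2}uv_vu -!mulmxA -mulmxN -uv.
  move/eqP; rewrite -addr_eq0 -mulr2n -scaler_nat scaler_eq0 (negPf F2) /=.
  by move/eqP->.
pose z := u + r *: v.
have zz : z *m z = (s ^+ 2)%:M.
  rewrite /z mulmxDl !mulmxDr -!scalemxAl -!scalemxAr uv scalerN addrA subrK.
  rewrite uu vv !scale_scalar_mx -raddfD sr; congr _%:M; ring.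
have [e e0 ez] : exists2 e : 'rV[F]_2, e != 0 & e *m z = s *: e.
  (* (z + s) (z - s) = 0, so the image of z + s consists of eigenvectors *)
  have [zs0|/nonzero_row[x xw]] := eqVneq (z + s%:M) 0; last first.
    exists (x *m (z + s%:M)) => //.
    rewrite -mulmxA scalemxAr; congr (_ *m _).
    by rewrite mulmxDl zz mul_scalar_mx [RHS]scalerDr scale_scalar_mx expr2 addrC.
  (* if z = - s then u is a polynomial in v *)
  have uE : u = - (r *: v) - s%:M.
    by apply: (addIr (r *: v + s%:M)); rewrite addrA zs0 -opprD addNr.
  have [e e0] : exists e : 'rV[F]_2, e != 0.
    by exists (const_mx 1); apply/rV0Pn; exists 0; rewrite mxE oner_eq0.
  case/eqP: (not_comm e e0); rewrite -!mulmxA; congr (e *m _).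
  by rewrite uE mulmxBl mulmxBr mulNmx mulmxN -scalemxAl -scalemxAr scalar_mxC.
have eu : e *m u = s *: e - r *: (e *m v).
  by apply: (addIr (r *: (e *m v))); rewrite subrK -ez mulmxDr -scalemxAr.
have ev_unit : basis2 e (e *m v) \in unitmx.
  apply: basis2_unit => [|k]; first exact: mulmx_neq0.
  apply/negP => /eqP ek; case/eqP: (not_comm e e0).
  have k0 : k != 0 by apply: contraNneq e0 => k0; rewrite ek k0 scale0r.
  have ev : e *m v = k^-1 *: e by rewrite {2}ek scalerA mulVf // scale1r.
  by rewrite eu ev scalerA -scalerBl -!scalemxAl ev eu ev !scalerA -scalerBl scalerA mulrC.
have evv : e *m v *m v = b *: e by rewrite -mulmxA vv mul_mx_scalar.
apply: (basis2_conj_pair ev_unit).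
- by rewrite scaleNr.
- rewrite -mulmxA -[v *m u]opprK -uv mulmxN mulmxA eu mulmxBl -!scalemxAl evv.
  by rewrite scalerA opprB scaleNr.
- by rewrite scale0r add0r scale1r.
by rewrite scale0r addr0.
Qed.

Lemma classification m : anticommuting_pair m ->
  exists2 x, nf_valid x & conj_pair m (nf_pair x).
Proof.
case: m => u v [/= uv uv_unit uv_unit'].
have [u0|u0] := eqVneq u 0.
  by rewrite u0 add0r in uv_unit; rewrite u0; apply: classify_u0.
have [v0|v0] := eqVneq v 0.
  by rewrite v0 addr0 in uv_unit; rewrite v0; apply: classify_v0.
have vu : v *m u = - (u *m v) by rewrite uv opprK.
have [uv0|uv0] := eqVneq (u *m v) 0.
  by apply: classify_split => //; rewrite vu uv0 oppr0.
have vu0 : v *m u != 0 by rewrite vu oppr_eq0.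
have uu := trace0_square (anticomm_trace0 uv uv0).
have vv := trace0_square (anticomm_trace0 vu vu0).
move: (- \det u) (- \det v) uu vv => a b uu vv.
have ab : a + b != 0.
  have : (u + v) *m (u + v) = (a + b)%:M.
    by rewrite mulmxDl !mulmxDr uv addrA subrK uu vv -raddfD.
  move/(congr1 (fun w : 'M_2 => w \in unitmx)); rewrite unitmx_mul uv_unit.
  rewrite mx2_scalar mx2_unit mulr0 subr0 => /esym e.
  have : (a + b) * (a + b) != 0 by rewrite e.
  by apply: contraNneq => ->; rewrite mulr0.
have [a0|a0] := eqVneq a 0.
  apply: classify_nilpotentU => //; first by rewrite uu a0 raddf0.
  by apply: scalar_square_unit vv; rewrite a0 add0r in ab.
have [b0|b0] := eqVneq b 0.
  apply: classify_nilpotentV => //; first by rewrite vv b0 raddf0.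
  exact: scalar_square_unit uu.
exists (Quaternionic a b); first exact/and3P.
exact: classify_quaternion.
Qed.

End NormalForms.

(** * Invariants and the number of normal forms *)

Section Invariants.
Local Open Scope ring_scope.
Variable F : finFieldType.
Hypothesis F2 : 2 != 0 :> F.
Implicit Types (u v g : 'M[F]_2) (e f : 'rV[F]_2) (m : 'M[F]_2 * 'M[F]_2).

Lemma nf_pair_anticommuting (x : normal_form F) :
  nf_valid x -> anticommuting_pair (nf_pair x).
Proof.
have scal a : a != 0 -> a%:M \in @unitmx F 2.
  by move=> a0; rewrite mx2_scalar mx2_unit mulr0 subr0 mulf_neq0.
have comp t d : d != 0 -> mx2 0 1 (- d) t \in @unitmx F 2.
  by move=> d0; rewrite mx2_unit mul0r mul1r sub0r opprK.
have unitN u : u \in unitmx -> - u \in unitmx.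
  by move=> u_unit; rewrite -scaleN1r unitmxZ // unitrN1.
case: x => [a|t d|a|t d|t s|a|a|a b] /=.
- by move=> a0; split; rewrite /= ?(mulmx0, mul0mx, oppr0, addr0) // scal.
- by move=> d0; split; rewrite /= ?(mulmx0, mul0mx, oppr0, addr0) // comp.
- by move=> a0; split; rewrite /= ?(mulmx0, mul0mx, oppr0, add0r) ?unitN // scal.
- by move=> d0; split; rewrite /= ?(mulmx0, mul0mx, oppr0, add0r) ?unitN // comp.
- case/andP=> t0 s0; split; rewrite /= ?mx2M ?mx2N ?mx2D ?mx2_unit.
  + by apply/mx2_eq; split; ring.
  + by rewrite (_ : _ - _ = t * s) ?mulf_neq0 //; ring.
  by rewrite (_ : _ - _ = - (t * s)) ?oppr_eq0 ?mulf_neq0 //; ring.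
- move=> a0; split; rewrite /= ?mx2M ?mx2N ?mx2D ?mx2_unit.
  + by apply/mx2_eq; split; ring.
  + by rewrite (_ : _ - _ = - (a * a)) ?oppr_eq0 ?mulf_neq0 //; ring.
  by rewrite (_ : _ - _ = - (a * a)) ?oppr_eq0 ?mulf_neq0 //; ring.
- move=> a0; split; rewrite /= ?mx2M ?mx2N ?mx2D ?mx2_unit.
  + by apply/mx2_eq; split; ring.
  + by rewrite (_ : _ - _ = - (a * a)) ?oppr_eq0 ?mulf_neq0 //; ring.
  by rewrite (_ : _ - _ = - (a * a)) ?oppr_eq0 ?mulf_neq0 //; ring.
case/and3P=> a0 b0 ab0; have := conic_pointP a b0.
case: (conic_point a b) => s r /= sr.
have aE : a = s ^+ 2 - b * r ^+ 2 by rewrite sr addrK.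
split; rewrite /= ?mx2M ?mx2N ?mx2D ?mx2_unit.
- by apply/mx2_eq; split; ring.
- rewrite (_ : _ - _ = - (a + b)) ?oppr_eq0 //; rewrite aE; ring.
by rewrite (_ : _ - _ = - (a + b)) ?oppr_eq0 //; rewrite aE; ring.
Qed.

(** The normal form of a pair, read off from conjugation invariants. Traces
    and determinants suffice unless u or v is scalar or nilpotent; in the
    nilpotent case the sign of the eigenvalue a shows in u v = - a u. *)
Definition nf_of m : normal_form F :=
  let: (u, v) := m in
  if u == 0 then
    if v == (\tr v / 2)%:M then ScalarV (\tr v / 2)
    else CompanionV (\tr v) (\det v)
  else if v == 0 then
    if u == (\tr u / 2)%:M then ScalarU (\tr u / 2)
    else CompanionU (\tr u) (\det u)
  else if \tr u != 0 then Diagonal (\tr u) (\tr v)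
  else if \det u == 0 then
    NilpotentU (odflt 0 [pick a | u *m v == - a *: u])
  else if \det v == 0 then
    NilpotentV (odflt 0 [pick a | v *m u == - a *: v])
  else Quaternionic (- \det u) (- \det v).

Lemma nf_of_conj m m' : conj_pair m m' -> nf_of m = nf_of m'.
Proof.
case: m m' => u v [u' v'] [g g_unit [/= gu gv]].
pose cj (w : 'M[F]_2) := g *m w *m invmx g.
have cjE w w' : g *m w = w' *m g -> w' = cj w.
  by move=> gw; rewrite /cj gw mulmxK.
have cjM w w' : cj (w *m w') = cj w *m cj w'.
  by rewrite /cj !mulmxA mulmxKV.
have cj_inj : injective cj.
  move=> w w' /(congr1 (fun z => invmx g *m (z *m g))).
  by rewrite /cj !mulmxKV // !mulKmx.
have cj_scal a : cj a%:M = a%:M.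
  by rewrite /cj scalar_mxC -mulmxA mulmxV // mulmx1.
have cj0 : cj 0 = 0 by rewrite /cj mulmx0 mul0mx.
have cjZ a w : cj (a *: w) = a *: cj w.
  by rewrite /cj -scalemxAr -scalemxAl.
have cj_tr w : \tr (cj w) = \tr w.
  by rewrite /cj mxtrace_mulC mulmxA mulVmx // mul1mx.
have cj_det w : \det (cj w) = \det w.
  rewrite /cj !det_mulmx det_inv mulrAC divff ?mul1r //.
  by rewrite -unitfE -unitmxE.
rewrite (cjE _ _ gu) (cjE _ _ gv) /= !cj_tr !cj_det.
have eq0 w : (cj w == 0) = (w == 0) by rewrite -{1}cj0 (inj_eq cj_inj).
have eq_scal w a : (cj w == a%:M) = (w == a%:M).
  by rewrite -{1}(cj_scal a) (inj_eq cj_inj).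
rewrite !eq0 !eq_scal.
have pickE w w' : [pick a | cj w *m cj w' == - a *: cj w] =
    [pick a | w *m w' == - a *: w].
  by apply: eq_pick => a /=; rewrite -cjM -cjZ (inj_eq cj_inj).
by rewrite (pickE u v) (pickE v u).
Qed.

Lemma nf_pairK (x : normal_form F) : nf_valid x -> nf_of (nf_pair x) = x.
Proof.
have mx2_eq0 a b c d : (mx2 a b c d == 0 :> 'M[F]_2) =
    [&& a == 0, b == 0, c == 0 & d == 0].
  rewrite mx2_0; apply/eqP/and4P => [/mx2_eq[-> -> -> ->]//|].
  by case=> /eqP-> /eqP-> /eqP-> /eqP->.
have scal (a : F) : a + a = a * 2 by ring.
have half (a : F) : (a + a) / 2 = a by rewrite scal mulfK.
have comp_scal (t d c : F) : mx2 0 1 (- d) t != c%:M.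
  rewrite mx2_scalar; apply/eqP => /mx2_eq[_ /eqP]; by rewrite oner_eq0.
case: x => [a|t d|a|t d|t s|a|a|a b] /=.
- move=> a0; rewrite mx2_scalar mx2_eq0 (negPf a0) /= eqxx mx2_tr half.
  by rewrite mx2_scalar eqxx.
- move=> d0; rewrite mx2_eq0 oner_eq0 andbF /= eqxx (negPf (comp_scal _ _ _)).
  by rewrite mx2_tr mx2_det add0r mul0r mul1r sub0r opprK.
- move=> a0; rewrite eqxx mx2_scalar mx2_tr half.
  by rewrite mx2_scalar eqxx.
- move=> d0; rewrite eqxx (negPf (comp_scal _ _ _)).
  by rewrite mx2_tr mx2_det add0r mul0r mul1r sub0r opprK.
- case/andP=> t0 s0; rewrite !mx2_eq0 (negPf t0) (negPf s0) /= !andbF !mx2_tr.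
  by rewrite addr0 add0r t0.
- move=> a0; rewrite !mx2_eq0 oner_eq0 (negPf a0) !andbF /= mx2_tr addr0 eqxx /=.
  rewrite mx2_det mul0r mulr0 subr0 eqxx.
  rewrite mx2M; congr NilpotentU; case: pickP => [b /=|/(_ a)/eqP[]]; last first.
    by rewrite mx2Z; apply/mx2_eq; split; ring.
  rewrite mx2Z => /eqP/mx2_eq[_ e _ _].
  by move: e; rewrite mul0r add0r mul1r mulr1 => /oppr_inj.
- move=> a0; rewrite !mx2_eq0 oner_eq0 (negPf a0) !andbF /= mx2_tr addrN eqxx /=.
  rewrite mx2_det mul0r subr0 mulrN oppr_eq0 mulf_eq0 (negPf a0) /=.
  rewrite mx2_det !mulr0 subr0 eqxx.
  rewrite mx2M; congr NilpotentV; case: pickP => [b /=|/(_ a)/eqP[]]; last first.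
    by rewrite mx2Z; apply/mx2_eq; split; ring.
  rewrite mx2Z => /eqP/mx2_eq[_ e _ _].
  by move: e; rewrite mul0r add0r mul1r mulr1 => /oppr_inj.
case/and3P=> a0 b0 ab0; have := conic_pointP a b0.
case: (conic_point a b) => s r /= sr.
have aE : a = s ^+ 2 - b * r ^+ 2 by rewrite sr addrK.
have det_u : \det (mx2 s (- r) (r * b) (- s)) = - a by rewrite mx2_det aE; ring.
have det_v : \det (mx2 0 1 b 0) = - b by rewrite mx2_det; ring.
rewrite det_u det_v !mx2_tr addrN eqxx /= !oppr_eq0 (negPf a0) (negPf b0) !opprK.
rewrite !mx2_eq0 oner_eq0 (negPf b0) !andbF /=.
case: ifP => // /and4P[/eqP s0 r0 _ _]; move: r0 a0; rewrite oppr_eq0 aE s0.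
by move/eqP->; rewrite !expr0n mulr0 subr0 eqxx.
Qed.

Lemma nf_pair_inj (x y : normal_form F) : nf_valid x -> nf_valid y ->
  conj_pair (nf_pair x) (nf_pair y) -> x = y.
Proof. by move=> xP yP /nf_of_conj; rewrite !nf_pairK. Qed.

(** The normal forms for which a constant c outside the image of
    1 - phi - psi = 1 - 2 u exists. *)
Definition singular_form (x : normal_form F) : bool :=
  1%:M - 2 *: (nf_pair x).1 \notin unitmx.

(** The vanishing of the determinant of 1 - 2 u, solved in each case. *)
Definition singular_test (x : normal_form F) : bool :=
  match x with
  | ScalarU a => a == 2^-1
  | CompanionU t d => t == 2^-1 + 2 * d
  | Diagonal t _ => t == 2^-1
  | NilpotentV a => (a == 2^-1) || (a == - 2^-1)
  | Quaternionic a _ => a == 4^-1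
  | ScalarV _ | CompanionV _ _ | NilpotentU _ => false
  end.

Lemma singular_formE x : nf_valid x -> singular_form x = singular_test x.
Proof.
have F4 : 4 != 0 :> F by rewrite (_ : 4 = 2 * 2) ?mulf_neq0 //; ring.
have scale_eq0 (k c z d : F) : k != 0 -> c = k * (z - d) -> (c == 0) = (z == d).
  by move=> k0 ->; rewrite mulf_eq0 (negPf k0) subr_eq0.
rewrite /singular_form.
case: x => [a|t d|a|t d|t s|a|a|a b] /= => [_|_|_|_|_|_|_|/and3P[_ b0 _]].
- rewrite !mx2_scalar mx2Z mx2N mx2D mx2_unit negbK.
  rewrite (_ : _ - _ = (1 - 2 * a) ^+ 2); last by ring.
  by rewrite sqrf_eq0; apply: (scale_eq0 (-2)); rewrite ?oppr_eq0 //; field.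
- rewrite !mx2_scalar mx2Z mx2N mx2D mx2_unit negbK.
  by apply: (scale_eq0 (-2)); rewrite ?oppr_eq0 //; field.
- by rewrite scaler0 subr0 unitmx1.
- by rewrite scaler0 subr0 unitmx1.
- rewrite !mx2_scalar mx2Z mx2N mx2D mx2_unit negbK.
  by apply: (scale_eq0 (-2)); rewrite ?oppr_eq0 //; field.
- rewrite !mx2_scalar mx2Z mx2N mx2D mx2_unit negbK.
  by rewrite (_ : _ - _ = 1) ?oner_eq0 //; ring.
- rewrite !mx2_scalar mx2Z mx2N mx2D mx2_unit negbK.
  rewrite (_ : _ - _ = (1 - 2 * a) * (1 - 2 * (- a))); last by ring.
  have half (c : F) : (1 - 2 * c == 0) = (c == 2^-1).
    by apply: (scale_eq0 (-2)); rewrite ?oppr_eq0 //; field.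
  by rewrite mulf_eq0 !half eqr_oppLR.
have := conic_pointP a b0; case: (conic_point a b) => s r /= sr.
have aE : a = s ^+ 2 - b * r ^+ 2 by rewrite sr addrK.
rewrite !mx2_scalar mx2Z mx2N mx2D mx2_unit negbK.
by apply: (scale_eq0 (-4)); rewrite ?oppr_eq0 // aE; field.
Qed.

Lemma sum_normal_form (G : normal_form F -> nat) :
  (\sum_x G x =
    \sum_a G (ScalarU a) + \sum_t \sum_d G (CompanionU t d) +
    (\sum_a G (ScalarV a) + \sum_t \sum_d G (CompanionV t d)) +
    (\sum_t \sum_s G (Diagonal t s) +
     (\sum_a G (NilpotentU a) + \sum_a G (NilpotentV a) +
      \sum_a \sum_b G (Quaternionic a b))))%N.
Proof.
rewrite (reindex (@nf_decode F)); last first.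
  by exists (@nf_code F) => x _; rewrite ?nf_codeK ?nf_decodeK.
rewrite !big_sumType /=.
have pairE (H : F -> F -> nat) :
  (\sum_(x : F * F) (let: (a, b) := x in H a b) = \sum_a \sum_b H a b)%N.
  by rewrite pair_bigA; apply: eq_bigr => -[].
by rewrite -!pairE; do !congr (_ + _)%N; apply: eq_bigr => -[].
Qed.

Local Notation q := #|F|.

Lemma sum_neq0 : (\sum_(a : F) (a != 0%R) = q - 1)%N.
Proof.
rewrite -big_mkcond sum1_card subn1 -(cardC1 (0 : F)).
by apply: eq_card => a; rewrite !inE.
Qed.

Lemma sum_eq (c : F) : (\sum_(a : F) (a == c) = 1)%N.
Proof. by rewrite -big_mkcond /= big_pred1_eq. Qed.

Lemma sum_neq0_eq (c : F) : c != 0 ->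
  (\sum_(a : F) (a != 0%R) * (1 + (a == c)) = q)%N.
Proof.
move=> c0; rewrite (eq_bigr (fun a : F => (a != 0%R) + (a == c))%N).
  by rewrite big_split /= sum_neq0 sum_eq subnK //; apply/card_gt0P; exists 0.
move=> a _; have [->|_] := eqVneq a c; first by rewrite c0.
by rewrite addn0 muln1 addn0.
Qed.

(** Case by case the sum is: q for the scalar u, (q - 1)(q + 1) for the
    companion u, q - 1 and q (q - 1) for the scalar and companion v,
    q (q - 1) for the diagonal pairs, q - 1 and q + 1 for u and v
    nilpotent, and q (q - 2) for the quaternionic pairs. *)
Lemma card_nf_total :
  (\sum_(x : normal_form F) nf_valid x * (1 + singular_form x) =
   4 * q ^ 2 - 2)%N.
Proof.
have q_gt1 : (1 < q)%N by have := card_finNzRing_gt1 F.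
have half0 : 2^-1 != 0 :> F by rewrite invr_eq0.
have F4 : 4^-1 != 0 :> F.
  by rewrite invr_eq0 (_ : 4 = 2 * 2) ?mulf_neq0 //; ring.
rewrite (eq_bigr (fun x => nf_valid x * (1 + singular_test x))%N); last first.
  by move=> x _; case: (boolP (nf_valid x)) => // /singular_formE->.
rewrite sum_normal_form /= !sum_neq0_eq //.
have -> : (\sum_(t : F) \sum_(d : F) (d != 0%R) * (1 + (t == 2^-1 + 2 * d)%R) =
    (q - 1) * (q + 1))%N.
  rewrite exchange_big /= -sum_neq0 big_distrl; apply: eq_bigr => d _ /=.
  by rewrite -big_distrr big_split /= sum_eq sum1_card.
have -> : (\sum_(a : F) (a != 0%R) * (1 + false) = q - 1)%N.
  by rewrite -big_distrl /= sum_neq0 muln1.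
have -> : (\sum_(t : F) \sum_(s : F) ((t != 0%R) && (s != 0%R)) * (1 + (t == 2^-1)%R) =
    q * (q - 1))%N.
  rewrite -{1}(sum_neq0_eq half0) big_distrl; apply: eq_bigr => t _ /=.
  rewrite -sum_neq0 big_distrr /=; apply: eq_bigr => s _.
  by rewrite -mulnb mulnAC.
have -> : (\sum_(a : F) (a != 0%R) * (1 + ((a == 2^-1) || (a == - 2^-1))%R) =
    q + 1)%N.
  transitivity (\sum_(a : F) ((a != 0%R) * (1 + (a == 2^-1)%R) +
      (a == - 2^-1)%R))%N; last by rewrite big_split /= sum_neq0_eq // sum_eq.
  apply: eq_bigr => a _; have [->|_ /=] := eqVneq a (- 2^-1).
    have halfN : (- 2^-1 == 2^-1 :> F) = false.
      by rewrite eq_sym -addr_eq0 -mulr2n -(mulr_natl 2^-1) divff // oner_eq0.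
    by rewrite oppr_eq0 half0 orbT halfN.
  by rewrite orbF addn0.
have -> : (\sum_(a : F) \sum_(b : F) [&& a != 0%R, b != 0%R & (a + b)%R != 0%R] *
    (1 + (a == 4^-1)%R) = q * (q - 2))%N.
  rewrite -{1}(sum_neq0_eq F4) big_distrl; apply: eq_bigr => a _ /=.
  have [->|a0] := eqVneq a 0; first by rewrite big1.
  rewrite mul1n.
  have -> : (q - 2 = \sum_(b : F) ((b != 0%R) && (a + b != 0)%R))%N.
    rewrite -big_mkcond sum1_card -[RHS]addn0.
    have := cardC [set 0; - a]; rewrite cards2 eq_sym oppr_eq0 a0 /= => <-.
    rewrite addKn addn0; apply: eq_card => b; rewrite !inE negb_or unfold_in.
    by rewrite [(a + b)%R]addrC addr_eq0.
  rewrite big_distrr /=; apply: eq_bigr => b _.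
  by rewrite mulnC.
rewrite sum_nat_const -[#|_|]/q.
nia.
Qed.

(** The boolean tells whether c lies outside the image of 1 - 2 u. *)
Definition elementary_form : Type :=
  {xb : normal_form F * bool | nf_valid xb.1 && (xb.2 ==> singular_form xb.1)}.
HB.instance Definition _ := Finite.on elementary_form.

Lemma card_elementary_form : #|{: elementary_form}| = (4 * q ^ 2 - 2)%N.
Proof.
rewrite card_sig -card_nf_total -sum1_card big_mkcond /=.
rewrite -(pair_bigA _ (fun x b =>
   if nf_valid x && (b ==> singular_form x) then 1%N else 0%N)) /=.
apply: eq_bigr => x _; rewrite big_bool /=.
by case: (nf_valid x); case: (singular_form x).
Qed.

End Invariants.

(** * Affine operations on a plane *)

Section Elementary.
Local Open Scope ring_scope.
Variable F : finFieldType.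
Hypotheses (F2 : 2 != 0 :> F) (F_prime : forall a : F, exists n, a = n%:R).
Implicit Types (g u v : 'M[F]_2) (m : 'M[F]_2 * 'M[F]_2) (c : 'rV[F]_2).

(** Over a prime field every additive map is linear. *)
Lemma additive_mx (phi : 'rV[F]_2 -> 'rV[F]_2) : additive_perm phi ->
  exists2 g, g \in unitmx & forall x, phi x = x *m g.
Proof.
case=> [[psi phiK psiK] phiD].
have phiZ a x : phi (a *: x) = a *: phi x.
  by have [n ->] := F_prime a; rewrite !scaler_nat (morph_addMn _ phiD).
pose g : 'M[F]_2 := \matrix_i phi (delta_mx 0 i).
have phiE x : phi x = x *m g.
  rewrite mulmx_sum_row {1}[x]row_sum_delta (big_morph phi phiD (morph_add0 phiD)).
  by apply: eq_bigr => i _; rewrite phiZ rowK.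
exists g => //; apply: (proj2 (@mulmx1_unit _ _ (\matrix_i psi (delta_mx 0 i)) g _)).
by apply/row_matrixP => i; rewrite row_mul rowK -phiE psiK row1.
Qed.

Definition rmul g (x : 'rV[F]_2) : 'rV[F]_2 := x *m g.

Lemma mx_additive_perm g : g \in unitmx -> additive_perm (rmul g).
Proof.
move=> g_unit; split=> [|x y]; last exact: mulmxDl.
by exists (rmul (invmx g)) => x; rewrite /rmul ?mulmxK ?mulmxKV.
Qed.

Definition mx_op m c := affine_op (rmul (m.1 + m.2)) (rmul (m.1 - m.2)) c.

Lemma anticommuting_paramedial m : anticommuting_pair m ->
  paramedial_pair (rmul (m.1 + m.2)) (rmul (m.1 - m.2)).
Proof.
case: m => u v [/= uv uv_unit uv_unit'].
split=> [||x]; [exact: mx_additive_perm | exact: mx_additive_perm |].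
rewrite /rmul -!mulmxA; congr (_ *m _).
rewrite !mulmxDl !mulmxDr !mulNmx !mulmxN opprK uv opprK.
by rewrite addrA subrK addrA addrK.
Qed.

Lemma mx_op_isoP m c m' c' : anticommuting_pair m -> anticommuting_pair m' ->
  op_iso (mx_op m c) (mx_op m' c') <->
  exists g b, [/\ g \in unitmx, g *m m'.1 = m.1 *m g, g *m m'.2 = m.2 *m g &
    c' = c *m g + b *m (1%:M - 2 *: m'.1)].
Proof.
move=> mP m'P.
have := affine_op_isoP c c' (anticommuting_paramedial mP) (anticommuting_paramedial m'P).
rewrite -/(mx_op m c) -/(mx_op m' c') => ->.
case: m m' {mP m'P} => u v [u' v'] /=; split; last first.
  case=> g [b [g_unit gu gv c'E]]; exists (rmul g), b; split=> /=.
  - exact: mx_additive_perm.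
  - by move=> x; rewrite /rmul -!mulmxA mulmxDr gu gv mulmxDl.
  - by move=> x; rewrite /rmul -!mulmxA mulmxBr gu gv mulmxBl.
  rewrite c'E -mulmxDr addrACA subrr addr0 -mulr2n -scaler_nat.
  rewrite mulmxBr mulmx1; set B := b *m _; rewrite addrCA; congr (_ + _).
  by rewrite addrCA subrr addr0.
case=> al [b [al_perm al1 al2 cE]]; have [g g_unit alE] := additive_mx al_perm.
have E1 : (u + v) *m g = g *m (u' + v').
  by apply/row_matrixP => i; rewrite !rowE !mulmxA; have := al1 (delta_mx 0 i); rewrite !alE.
have E2 : (u - v) *m g = g *m (u' - v').
  by apply/row_matrixP => i; rewrite !rowE !mulmxA; have := al2 (delta_mx 0 i); rewrite !alE.
have half (w z : 'M[F]_2) : w + w = z + z -> w = z.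
  rewrite -!mulr2n -!scaler_nat; exact/scalerI/F2.
have sumE (w z : 'M[F]_2) : w + z + (w - z) = w + w.
  by rewrite addrACA subrr addr0.
have diffE (w z : 'M[F]_2) : w + z - (w - z) = z + z.
  by rewrite opprB [w + z]addrC addrACA subrr addr0.
exists g, b; split=> //.
- apply: half; have := congr2 +%R E1 E2.
  by rewrite -mulmxDl -mulmxDr !sumE mulmxDl mulmxDr => ->.
- apply: half; have := congr2 (fun x y => x - y) E1 E2.
  by rewrite -mulmxBl -mulmxBr !diffE mulmxDl mulmxDr => ->.
apply: (addrI (b *m (u' + v') + b *m (u' - v'))); rewrite -cE alE.
rewrite -mulmxDr addrACA subrr addr0 -mulr2n -scaler_nat.
by rewrite mulmxBr mulmx1 addrCA [_ *m _ + (b - _)]addrC subrK.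
Qed.

Lemma nonzero_basis c : c != 0 -> exists f, basis2 c f \in unitmx.
Proof.
move=> c0; pose rw (x y : F) : 'rV[F]_2 := \row_j (if j == 0 then x else y).
have [c00|c00] := eqVneq (c 0 0) 0; last first.
  exists (rw 0 1); rewrite basis2E mx2_unit !mxE /=.
  by rewrite mulr1 mulr0 subr0.
exists (rw 1 0); rewrite basis2E mx2_unit !mxE /= c00 mul0r mulr1 sub0r oppr_eq0.
by apply: contraNneq c0 => c01; apply/eqP/row2P; rewrite !mxE.
Qed.

(** If u <> 1/2, the cokernel of the singular matrix 1 - 2 u is a line, on
    whose nonzero vectors scalar matrices act transitively. If u = 1/2, then v = 0 because it anticommutes with u;
    every invertible matrix commutes with the pair, and any two nonzero vectors
    are related by one. *)
Lemma coker_transitive m c c' : anticommuting_pair m ->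
    ~~ (c <= 1%:M - 2 *: m.1)%MS -> ~~ (c' <= 1%:M - 2 *: m.1)%MS ->
  exists g b, [/\ g \in unitmx, g *m m.1 = m.1 *m g, g *m m.2 = m.2 *m g &
    c' = c *m g + b *m (1%:M - 2 *: m.1)].
Proof.
case: m => u v [/= uv _ _]; set M := 1%:M - _ => cM c'M.
have [M0|/nonzero_row[z zM0]] := eqVneq M 0.
  have v0 : v = 0.
    have e : (2 *: u) = 1%:M by apply/esym/eqP; rewrite -subr_eq0 -/M M0.
    have : (2 *: u) *m v + v *m (2 *: u) = 0.
      by rewrite -scalemxAl -scalemxAr uv scalerN addNr.
    rewrite e mul1mx mulmx1 -mulr2n -scaler_nat => /eqP.
    by rewrite scaler_eq0 (negPf F2) => /eqP.
  have uE : u = (2^-1)%:M.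
    apply: (scalerI F2); rewrite scale_scalar_mx divff ?F2 //.
    by apply/esym/eqP; rewrite -subr_eq0 -/M M0.
  rewrite M0 in cM c'M *; rewrite !submx0 in cM c'M.
  have [f cf] := nonzero_basis cM; have [f' cf'] := nonzero_basis c'M.
  exists (invmx (basis2 c f) *m basis2 c' f'), 0; split.
  - by rewrite unitmx_mul unitmx_inv cf.
  - by rewrite uE scalar_mxC.
  - by rewrite v0 mulmx0 mul0mx.
  rewrite mul0mx addr0.
  have row0E a b : row 0 (basis2 a b) = a :> 'rV[F]_2 by rewrite rowK.
  rewrite -{1}(row0E c f) mulmxA -row_mul mulmxV // row1 -rowE row0E //.
have zM : (z *m M <= M)%MS by apply: submxMl.
have cz_unit : basis2 c (z *m M) \in unitmx.
  by apply: basis2_unit => // k; apply: contraNneq cM => ->; apply: scalemx_sub.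
have [k [l c'E]] := basis2_coord c' cz_unit.
exists k%:M, (l *: z); split.
- rewrite mx2_scalar mx2_unit mulr0 subr0 mulf_neq0 //;
  by apply: contraNneq c'M => k0; rewrite c'E k0 scale0r add0r scalemx_sub.
- by rewrite scalar_mxC.
- by rewrite scalar_mxC.
by rewrite mul_mx_scalar -scalemxAl.
Qed.

Definition coker_vector m : 'rV[F]_2 :=
  odflt 0 [pick c | ~~ (c <= 1%:M - 2 *: m.1)%MS].

Lemma coker_vectorP m : 1%:M - 2 *: m.1 \notin unitmx ->
  ~~ (coker_vector m <= 1%:M - 2 *: m.1)%MS.
Proof.
rewrite /coker_vector; set M := 1%:M - _ => M_sing.
case: pickP => //= all_sub; case/negP: M_sing.
rewrite -row_full_unit -sub1mx; apply/row_subP => i.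
by have /negbFE := all_sub (row i 1%:M).
Qed.

Definition nf_op (x : normal_form F) (b : bool) :=
  mx_op (nf_pair x) (if b then coker_vector (nf_pair x) else 0).

Definition elementary_op (x : elementary_form F) := nf_op (val x).1 (val x).2.

Lemma elementary_op_paramedial x : paramedial_quasigroup (elementary_op x).
Proof.
apply/affine_op_paramedial/anticommuting_paramedial/nf_pair_anticommuting.
by case: x => [[x b] /= /andP[]].
Qed.

(** The image of 1 - 2 u is stable under every matrix that commutes with u, so
    whether c belongs to it is an invariant. *)
Lemma nf_op_iso (z t : normal_form F) b b' : nf_valid z -> nf_valid t ->
    b ==> singular_form z -> op_iso (nf_op z b) (nf_op t b') ->
  z = t /\ (b -> b').
Proof.
move=> z_valid t_valid z_sing zt_iso.
have zP := nf_pair_anticommuting z_valid; have tP := nf_pair_anticommuting t_valid.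
have [g [d [g_unit gu gv cE]]] := (mx_op_isoP _ _ zP tP).1 zt_iso.
have zt : t = z by apply: (nf_pair_inj F2) => //; exists g.
split=> [//|b_true]; rewrite b_true /= in z_sing cE.
case: b' cE {zt_iso} => //= cE; have := coker_vectorP z_sing.
case/negP; rewrite zt in gu cE.
have -> : coker_vector (nf_pair z) =
    - (d *m (1%:M - 2 *: (nf_pair z).1) *m invmx g).
  rewrite -mulNmx; apply: (can_inj (mulmxK g_unit)).
  by rewrite mulmxKV //; apply/eqP; rewrite -addr_eq0 -cE.
rewrite eqmx_opp -mulmxA.
have -> : (1%:M - 2 *: (nf_pair z).1) *m invmx g =
    invmx g *m (1%:M - 2 *: (nf_pair z).1).
  apply: (can_inj (mulmxK g_unit)); rewrite mulmxKV // -mulmxA.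
  apply: (can_inj (mulKmx g_unit)); rewrite mulKVmx //.
  by rewrite mulmxBr mulmxBl mulmx1 mul1mx -scalemxAl -scalemxAr gu.
by rewrite mulmxA submxMl.
Qed.

Lemma elementary_op_inj x y : op_iso (elementary_op x) (elementary_op y) -> x = y.
Proof.
have [/andP[xv xs] /andP[yv ys]] := (valP x, valP y).
move=> xy; have [e le] := nf_op_iso xv yv xs xy.
have [_ ge] := nf_op_iso yv xv ys (op_iso_sym xy).
apply: val_inj; rewrite [LHS]surjective_pairing [RHS]surjective_pairing e.
by congr (_, _); apply/idP/idP.
Qed.

(** The pair (phi, psi) is brought to normal form first; then the constant is
    translated to 0 if it lies in the image of 1 - 2 u, and moved to the chosen
    vector outside that image otherwise. *)
Lemma elementary_op_surj (phi psi : 'rV[F]_2 -> 'rV[F]_2) c :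
  paramedial_pair phi psi -> exists x, op_iso (affine_op phi psi c) (elementary_op x).
Proof.
case=> /additive_mx[A A_unit phiE] /additive_mx[B B_unit psiE] pp.
have AB : A *m A = B *m B.
  apply/row_matrixP => i; rewrite !rowE !mulmxA -!phiE -!psiE; exact: pp.
pose m := (2^-1 *: (A + B), 2^-1 *: (A - B)).
have half (w : 'M[F]_2) : 2^-1 *: (w + w) = w.
  by rewrite -mulr2n -scaler_nat scalerA mulVf ?F2 ?scale1r.
have mD : m.1 + m.2 = A by rewrite /= -scalerDr addrACA subrr addr0 half.
have mB : m.1 - m.2 = B.
  by rewrite /= -scalerBr opprB addrACA [A + _]addrC addrACA subrr addr0 half.
have mP : anticommuting_pair m.
  split; rewrite ?mD ?mB //= -!scalemxAl -!scalemxAr -!scalerN; do 2!congr (_ *: _).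
  rewrite !mulmxDl !mulmxDr !mulNmx !mulmxN AB !opprD !opprK.
  by rewrite [LHS]addrC [RHS]addrC !addrA subrK addrK.
have [x x_valid [g g_unit [gu gv]]] := classification F2 mP.
have xP := nf_pair_anticommuting x_valid.
have mx_iso : op_iso (affine_op phi psi c) (mx_op m c).
  exists id; first by exists id.
  by move=> a b; rewrite /mx_op /affine_op mD mB phiE psiE.
suff [y y_iso] : exists y, op_iso (mx_op m c) (elementary_op y).
  by exists y; apply: op_iso_trans mx_iso y_iso.
pose c1 := c *m invmx g.
have invg w w' : g *m w = w' *m g -> invmx g *m w' = w *m invmx g.
  by move=> e; rewrite -[w'](mulmxK g_unit) -e !mulmxA mulVmx // mul1mx.
have x_iso : op_iso (mx_op m c) (mx_op (nf_pair x) c1).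
  apply/(mx_op_isoP _ _ mP xP); exists (invmx g), 0.
  by rewrite unitmx_inv mul0mx addr0 !(invg _ _ gu) !(invg _ _ gv).
pose M := 1%:M - 2 *: (nf_pair x).1.
have [/submxP[d c1E]|c1_notin] := boolP (c1 <= M)%MS.
  have valid : nf_valid (x, false).1 && ((x, false).2 ==> singular_form (x, false).1).
    by rewrite /= x_valid.
  exists (exist _ (x, false) valid); apply: op_iso_trans x_iso _.
  apply/(mx_op_isoP _ _ xP xP); exists 1%:M, (- d).
  by rewrite unitmx1 !mul1mx !mulmx1 c1E mulNmx addrN.
have x_sing : singular_form x.
  apply: contraNN c1_notin => M_unit.
  by rewrite submx_full // row_full_unit.
have valid : nf_valid (x, true).1 && ((x, true).2 ==> singular_form (x, true).1).
  by rewrite /= x_valid.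
exists (exist _ (x, true) valid); apply: op_iso_trans x_iso _.
apply/(mx_op_isoP _ _ xP xP); apply: coker_transitive => //.
exact: coker_vectorP.
Qed.

End Elementary.

(** * The two counts *)

Section Assembly.

Lemma affine_op_transport (A B : zmodType) (s : A -> B) (phi psi : B -> B) c :
    additive_perm s -> paramedial_pair phi psi ->
  exists (phi' psi' : A -> A) (c' : A), paramedial_pair phi' psi' /\
    op_iso (affine_op phi psi c) (affine_op phi' psi' c').
Proof.
case=> [[t sK tK] sD] [[phi_bij phiD] [psi_bij psiD] pp].
have t_bij : bijective t by exists s.
have tD : {morph t : x y / (x + y)%R}.
  by move=> x y; apply: (can_inj sK); rewrite sD !tK.
exists (fun x => t (phi (s x))), (fun x => t (psi (s x))), (t c).
have s_bij : bijective s by exists t.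
split; [split|].
- split; last by move=> x y; rewrite sD phiD tD.
  exact: bij_comp t_bij (bij_comp phi_bij s_bij).
- split; last by move=> x y; rewrite sD psiD tD.
  exact: bij_comp t_bij (bij_comp psi_bij s_bij).
- by move=> x; rewrite !tK pp.
by exists t => // x y; rewrite /affine_op !tD !tK.
Qed.

Lemma paramedial_quasigroups_affine n (f : {ffun 'I_n * 'I_n -> 'I_n}) :
    0 < n -> f \in paramedial_quasigroups 'I_n ->
  exists (Z : finZmodType) (phi psi : Z -> Z) (c : Z),
    [/\ #|Z| = n, paramedial_pair phi psi &
        op_iso (fun x y => f (x, y)) (affine_op phi psi c)].
Proof.
move=> n_gt0 /paramedial_quasigroupsP fP.
by have := paramedial_affine (Ordinal n_gt0) fP; rewrite card_ord.
Qed.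

Lemma pq_card_ops n (X : finType) (A : X -> finType)
    (h : forall x, A x -> A x -> A x) :
    (forall x, #|A x| = n) ->
    (forall x, paramedial_quasigroup (@h x)) ->
    (forall x y, op_iso (@h x) (@h y) -> x = y) ->
    (forall f, f \in paramedial_quasigroups 'I_n ->
       exists x, op_iso (fun x y => f (x, y)) (@h x)) ->
  pq n = #|X|.
Proof.
move=> cardA hP h_inj h_surj.
pose r x := ord_op (cardA x) (@h x).
have rh x := ord_op_iso (cardA x) (@h x).
apply: (pq_card (r := r)) => [x|x y /isomorphic_op_iso xy|f /h_surj[x fx]].
- by apply/paramedial_quasigroupsP/(op_iso_paramedial_quasigroup (rh x)).
- by apply: h_inj; apply: op_iso_trans (rh x) (op_iso_trans xy (op_iso_sym (rh y))).
exists x; apply/isomorphic_op_iso.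
exact: op_iso_trans (op_iso_sym (rh x)) (op_iso_sym fx).
Qed.

Variable p : nat.
Hypotheses (p_prime : prime p) (p_odd : odd p).

Lemma Fp_2neq0 : (2 != 0 :> 'F_p)%R.
Proof.
rewrite -(dvdn_pcharf (pchar_Fp p_prime)) gtnNdvd //.
by case: p p_prime p_odd => [|[|[|]]].
Qed.

Lemma Fp_natr (a : 'F_p) : exists n, (a = n%:R)%R.
Proof. by exists a; rewrite natr_Zp. Qed.

Lemma pq_prime : pq p = 2 * p - 1.
Proof.
have p_gt1 := prime_gt1 p_prime.
rewrite (@pq_card_ops p (cyclic_form p 1) (fun=> 'Z_(p ^ 1)) (@cyclic_op p 1)).
- rewrite card_cyclic_form // big_nat1 subnn expn1 totient_prime //.
  by case: p p_gt1 => [|[|m]] //; lia.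
- by move=> x; rewrite card_Zn // expn1.
- exact: cyclic_op_paramedial.
- exact: cyclic_op_inj.
move=> f /(paramedial_quasigroups_affine (ltnW p_gt1)).
case=> Z [phi [psi [c [Zp pp f_iso]]]].
have [s s_perm] := zmod_prime p_prime Zp.
have {s s_perm} [s s_perm] : exists s : 'Z_(p ^ 1) -> Z, additive_perm s.
  by rewrite expn1; exists s.
have [phi' [psi' [c' [pp' iso']]]] := affine_op_transport c s_perm pp.
have [x x_iso] := @cyclic_op_surj p 1 p_prime p_odd isT phi' psi' c' pp'.
by exists x; apply: op_iso_trans f_iso (op_iso_trans iso' x_iso).
Qed.

(** An isomorphism would have an additive linear part, but p kills the plane
    and not the cyclic group. *)
Lemma cyclic_neq_elementary (x : cyclic_form p 2) (y : elementary_form 'F_p) :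
  ~ op_iso (cyclic_op x) (elementary_op y).
Proof.
suff no_additive (al : 'Z_(p ^ 2) -> 'rV['F_p]_2) : ~ additive_perm al.
  have yP : anticommuting_pair (nf_pair (val y).1).
    by apply: nf_pair_anticommuting; case/andP: (valP y).
  have pp := anticommuting_paramedial yP.
  case: x => [w|[[w i] wi]] /=.
    case/(affine_op_isoP _ _ (opposite_pair (valP w)) pp) => al [b [al_perm _ _ _]].
    exact: no_additive al_perm.
  case/(affine_op_isoP _ _ (equal_pair (valP w)) pp) => al [b [al_perm _ _ _]].
  exact: no_additive al_perm.
case=> /bij_inj al_inj alD.
have : (p%:R == 0 :> 'Z_(p ^ 2))%R.
  apply/eqP/al_inj; rewrite (morph_addMn _ alD) (morph_add0 alD).
  by rewrite -scaler_nat (pchar_Fp_0 p_prime) scale0r.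
by rewrite natr_Zn_eq0 // -{2}[p]expn1 dvdn_Pexp2l // prime_gt1.
Qed.

Lemma pq_prime_square : pq (p ^ 2) = 6 * p ^ 2 - p - 1.
Proof.
have p_gt1 := prime_gt1 p_prime.
pose X : finType := (cyclic_form p 2 + elementary_form 'F_p)%type.
pose A (x : X) : finType := if x is inl _ then 'Z_(p ^ 2) else 'rV['F_p]_2.
pose h (x : X) : A x -> A x -> A x :=
  match x with inl z => cyclic_op z | inr z => elementary_op z end.
rewrite (@pq_card_ops _ X A h).
- rewrite card_sum card_cyclic_form // (card_elementary_form Fp_2neq0).
  rewrite card_Fp // totient_pfactor // big_nat_recl // big_nat1 subnn expn1.
  case: p p_gt1 => [|[|m]] //=; nia.
- by case=> x; [rewrite card_Zn | rewrite card_mx card_Fp].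
- by case=> x; [apply: cyclic_op_paramedial | apply: elementary_op_paramedial].
- case=> x [] y xy.
  + by rewrite (cyclic_op_inj p_prime p_odd _ xy).
  + by case: (cyclic_neq_elementary xy).
  + by case: (cyclic_neq_elementary (op_iso_sym xy)).
  by rewrite (elementary_op_inj Fp_2neq0 Fp_natr xy).
move=> f fP; have p2_gt0 : 0 < p ^ 2 by rewrite expn_gt0 ltnW.
have [Z [phi [psi [c [Zp pp f_iso]]]]] := paramedial_quasigroups_affine p2_gt0 fP.
have [[s s_perm]|[s s_perm]] := zmod_prime_square p_prime Zp;
  have [phi' [psi' [c' [pp' iso']]]] := affine_op_transport c s_perm pp.
  have [x x_iso] := @cyclic_op_surj p 2 p_prime p_odd isT phi' psi' c' pp'.
  by exists (inl x); apply: op_iso_trans f_iso (op_iso_trans iso' x_iso).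
have [x x_iso] := elementary_op_surj Fp_2neq0 Fp_natr c' pp'.
by exists (inr x); apply: op_iso_trans f_iso (op_iso_trans iso' x_iso).
Qed.

End Assembly.

Theorem corollary1p2 (p : nat) (hp : prime p) (hodd : odd p) :
  pq p = 2 * p - 1 /\ pq (p ^ 2) = 6 * p ^ 2 - p - 1.
Proof. by split; [apply: pq_prime | apply: pq_prime_square]. Qed.
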